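(* Suppose that Assumptions A and B (written out in the context) hold. Let $\theta\in\Theta_0$, let $(\tau_n)$ be a sequence in $\mathbb{R}^p$ with $\tau_n\to\tau$, and let $\theta_n=\theta+\nu_n\tau_n\in\Theta$ for all $n$. Let $\hat\theta_{\rm PTE}=\mathbb{I}[\phi_n=1]\,\hat\theta_{\rm U}+\mathbb{I}[\phi_n=0]\,\hat\theta_{\rm C}$. Then, conditional on $D^{(n)}=D$, $\nu_n^{-1}(\hat\theta_{\rm PTE}-\theta_n)$ is, under ${\rm P}^{(n)}_{\theta_n}$, asymptotically normal with mean vector $$\mu^{\rm Vic}_{\rm PTE}=(1-\lambda(\|D\|^2))\left\{(A_\theta\Omega_\theta-I_p)\tau+A_\theta\Sigma_\theta C_\theta'(C_\theta\Sigma_\theta C_\theta')^{-}(D-C_\theta\Omega_\theta\tau)\right\}$$ $$\qquad+\lambda(\|D\|^2)\left\{(\Upsilon B_\theta\Omega_\theta-I_p)\tau+\Upsilon B_\theta\Sigma_\theta C_\theta'(C_\theta\Sigma_\theta C_\theta')^{-}(D-C_\theta\Omega_\theta\tau)\right\}$$ and covariance matrix $$\Gamma^{\rm Vic}_{\rm PTE}=(1-\lambda(\|D\|^2))\,A_\theta(\Sigma_\theta-L_\theta)A_\theta'+\lambda(\|D\|^2)\,\Upsilon B_\theta(\Sigma_\theta-L_\theta)B_\theta'\Upsilon',$$ where $L_\theta:=\Sigma_\theta C_\theta'(C_\theta\Sigma_\theta C_\theta')^{-}C_\theta\Sigma_\theta$. Here the conditional asymptotic statement means: under ${\rm P}^{(n)}_{\theta_n}$,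 the pair $\left(\nu_n^{-1}(\hat\theta_{\rm PTE}-\theta_n),\,D^{(n)}\right)$ converges weakly to a pair $(Z,D)$ of random $p$-vectors such that the conditional distribution of $Z$ given $D$ is the (possibly degenerate) $p$-variate normal distribution with mean vector $\mu^{\rm Vic}_{\rm PTE}$ and covariance matrix $\Gamma^{\rm Vic}_{\rm PTE}$ (both functions of $D$).
   Context: All limits are as $n\to\infty$. $\Theta\subset\mathbb{R}^p$ is open and $\{{\rm P}^{(n)}_\theta:\theta\in\Theta\}$ is, for each $n$, a parametric family of probability measures. The constraint set is $\Theta_0=\mathcal{M}(\Upsilon)\cap\Theta$, where $\Upsilon$ is a fixed $p\times r$ matrix of full rank $r<p$ and $\mathcal{M}(\Upsilon)$ is the linear span of its columns. $\mathbb{I}[A]$ is the indicator of $A$; a prime denotes transposition; $M^{-}$ is the Moore–Penrose inverse of $M$; $I_p$ is the identity matrix; $\|\cdot\|$ is the Euclidean norm. $\chi^2_{\ell,\beta}$ denotes the quantile of order $\beta$ of the $\chi^2_\ell$ distribution (the probability of being $\le\chi^2_{\ell,\beta}$ is $\beta$), and $\lambda(v):=\mathbb{I}[v\le\chi^2_{p-r,1-\alpha}]$. The unconstrained estimator $\hat\theta_{\rm U}$ takes values in $\Theta$, the constrained estimator $\hat\theta_{\rm C}$ takes values in $\Theta_0$, and $\phi_n\in\{0,1\}$ is a test of $\mathcal{H}_0:\theta\in\Theta_0$ against $\mathcal{H}_1:\theta\notin\Theta_0$ ($\phi_n=1$ meaning rejection); all are functions of the $n$th observation. Assumption A (ULAN).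 There exists a sequence $(\nu_n)$ of non-random full-rank $p\times p$ matrices with $\nu_n=o(1)$ such that, for every $\theta\in\Theta$, every sequence $(\theta_n)$ in $\Theta$ with $\nu_n^{-1}(\theta_n-\theta)=O(1)$ and every sequence $(\tau_n)$ in $\mathbb{R}^p$ with $\tau_n=O(1)$ and $\theta_n+\nu_n\tau_n\in\Theta$ for all $n$, $$\log\frac{d{\rm P}^{(n)}_{\theta_n+\nu_n\tau_n}}{d{\rm P}^{(n)}_{\theta_n}}=\tau_n'\Delta^{(n)}_{\theta_n}-\tfrac12\tau_n'\Gamma_\theta\tau_n+o_{\rm P}(1)$$ under ${\rm P}^{(n)}_\theta$, where the random $p$-vector $\Delta^{(n)}_\theta$ is, under ${\rm P}^{(n)}_\theta$, asymptotically normal with mean $0$ and covariance matrix $\Gamma_\theta$. Assumption B. With $\nu_n$ and $\Delta^{(n)}_\theta$ as in Assumption A, there exists a random $p$-vector $S^{(n)}_\theta$ such that, under ${\rm P}^{(n)}_\theta$, $(S^{(n)\prime}_\theta,\Delta^{(n)\prime}_\theta)'$ is asymptotically normal with mean $0$ and covariance matrix $\begin{pmatrix}\Sigma_\theta&\Omega_\theta\\ \Omega_\theta'&\Gamma_\theta\end{pmatrix}$ and such that, for some $p\times p$ matrix $A_\theta$ and $r\times p$ matrix $B_\theta$: (i) $\nu_n^{-1}(\hat\theta_{\rm U}-\theta)=A_\theta S^{(n)}_\theta+o_{\rm P}(1)$ under ${\rm P}^{(n)}_\theta$, for $\theta\in\Theta$; (ii) $\nu_n^{-1}(\hat\theta_{\rm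 C}-\theta)=\Upsilon B_\theta S^{(n)}_\theta+o_{\rm P}(1)$ under ${\rm P}^{(n)}_\theta$, for $\theta\in\Theta_0$; (iii) $\phi_n$ rejects $\mathcal{H}_0$ at asymptotic level $\alpha$ when $Q^{(n)}:=\|D^{(n)}\|^2>\chi^2_{p-r,1-\alpha}$ (that is, $\phi_n=\mathbb{I}[Q^{(n)}>\chi^2_{p-r,1-\alpha}]$), where $D^{(n)}$ is a random $p$-vector (a statistic) such that $D^{(n)}=C_\theta S^{(n)}_\theta+o_{\rm P}(1)$ under ${\rm P}^{(n)}_\theta$, $\theta\in\Theta_0$, for some $p\times p$ matrix $C_\theta$ satisfying $\Sigma_\theta C_\theta'C_\theta\Sigma_\theta C_\theta'C_\theta\Sigma_\theta=\Sigma_\theta C_\theta'C_\theta\Sigma_\theta$ and ${\rm tr}[C_\theta'C_\theta\Sigma_\theta]=p-r$. Furthermore, the probability of $Q^{(n)}>\chi^2_{p-r,1-\alpha}$ converges to one under ${\rm P}^{(n)}_\theta$ for every $\theta\in\Theta\setminus\Theta_0$. *)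

(* Defs.v *)
From HB Require Import structures.
From mathcomp Require Import all_boot all_order all_algebra.
From mathcomp Require Import all_classical all_reals all_analysis.
Set Implicit Arguments.
Unset Strict Implicit.
Unset Printing Implicit Defensive.
Import Order.TTheory GRing.Theory Num.Theory.
Import numFieldNormedType.Exports.
Local Open Scope classical_set_scope.
Local Open Scope ring_scope.

(* Matrices, in particular the column vectors ['cV[R]_k] standing for R^k,
   carry the Borel sigma-algebra of their topology. *)
HB.instance Definition _ (R : realType) (m n : nat) :=
  @isMeasurable.Build (sigma_display (@open 'M[R]_(m, n))) 'M[R]_(m, n)
    <<s (@open 'M[R]_(m, n)) >> (@sigma_algebra0 _ setT _)
    (@sigma_algebraC _ _) (@sigma_algebra_bigcup _ setT _).

(* The library's norm on matrices is the sup norm; this is the square of the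
   Euclidean one. *)
Definition sqnorm (R : realType) (k : nat) (v : 'cV[R]_k) : R :=
  (v^T *m v) 0 0.

Definition enorm (R : realType) (k : nat) (v : 'cV[R]_k) : R :=
  Num.sqrt (sqnorm v).

Definition moore_penrose (R : realType) (m n : nat)
    (M : 'M[R]_(m, n)) (G : 'M[R]_(n, m)) : Prop :=
  [/\ M *m G *m M = M, G *m M *m G = G,
      (M *m G)^T = M *m G & (G *m M)^T = G *m M].

Definition mpinv (R : realType) (m n : nat) (M : 'M[R]_(m, n)) : 'M[R]_(n, m) :=
  xget 0 [set G | moore_penrose M G].

Lemma moore_penrose_uniq (R : realType) (m n : nat)
    (M : 'M[R]_(m, n)) (G H : 'M[R]_(n, m)) :
  moore_penrose M G -> moore_penrose M H -> G = H.
Proof.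
move=> [MGM GMG sMG sGM] [MHM HMH sMH sHM].
have eM : M *m G = M *m H.
  have : (M *m H *m (M *m G))^T = M *m H by rewrite trmx_mul sMG sMH mulmxA MGM.
  by rewrite mulmxA MHM sMG.
have eG : G *m M = H *m M.
  have : (G *m M *m (H *m M))^T = H *m M.
    by rewrite trmx_mul sGM sHM -mulmxA (mulmxA M) MGM.
  by rewrite -mulmxA (mulmxA M) MHM sGM.
by rewrite -GMG eG -mulmxA eM mulmxA HMH.
Qed.

Lemma gram_unit (R : realType) (m n : nat) (F : 'M[R]_(m, n)) :
  \rank F = n -> F^T *m F \in unitmx.
Proof.
have sq0 (w : 'rV[R]_m) : w *m w^T = 0 -> w = 0.
  move=> /matrixP/(_ 0 0); rewrite !mxE => /eqP.
  under eq_bigr => i _ do rewrite mxE -expr2.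
  rewrite (psumr_eq0 _ (fun i _ => sqr_ge0 (w 0 i))) => /allP w0.
  apply/rowP => j; rewrite mxE; apply/eqP; rewrite -sqrf_eq0.
  by apply: w0; rewrite mem_index_enum.
move=> rF; rewrite -row_free_unit -kermx_eq0.
apply/rowV0P => v /sub_kermxP vF.
have /sq0 vF0 : v *m F^T *m (v *m F^T)^T = 0.
  by rewrite trmx_mul trmxK mulmxA -[v *m _ *m F]mulmxA vF mul0mx.
have fF : row_free F^T by rewrite /row_free mxrank_tr rF.
by apply/eqP; rewrite -(mulmx_free_eq0 v fF) vF0.
Qed.

Lemma mpinvP (R : realType) (m n : nat) (M : 'M[R]_(m, n)) :
  moore_penrose M (mpinv M).
Proof.
suff [G MG] : exists G, moore_penrose M G.
  by apply: (@xgetPex _ 0 [set G | moore_penrose M G]); exists G.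
have [k [F [K [FK rF rK]]]] : exists k (F : 'M[R]_(m, k)) (K : 'M[R]_(k, n)),
    [/\ F *m K = M, \rank F = k & \rank K = k].
  exists (\rank M), (col_base M), (row_base M); split; first exact: mulmx_base.
    exact: eqP (col_base_full M).
  exact: eqP (row_base_free M).
have uF : F^T *m F \in unitmx by exact: gram_unit.
have uK : K *m K^T \in unitmx.
  by rewrite -[X in X *m _]trmxK; apply: gram_unit; rewrite mxrank_tr.
pose X := invmx (F^T *m F) *m F^T; pose Y := K^T *m invmx (K *m K^T).
have XF : X *m F = 1%:M by rewrite -mulmxA mulVmx.
have KY : K *m Y = 1%:M by rewrite mulmxA mulmxV.
have MG : M *m (Y *m X) = F *m X by rewrite -FK -mulmxA (mulmxA K) KY mul1mx.
have GM : Y *m X *m M = Y *m K by rewrite -FK -mulmxA (mulmxA X) XF mul1mx.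
exists (Y *m X); split; rewrite ?MG ?GM.
- by rewrite -FK -mulmxA (mulmxA X) XF mul1mx.
- by rewrite -mulmxA (mulmxA K) KY mul1mx.
- by rewrite /X !trmx_mul trmxK trmx_inv trmx_mul trmxK mulmxA.
- by rewrite /Y !trmx_mul trmxK trmx_inv trmx_mul trmxK mulmxA.
Qed.

HB.instance Definition _ d (T : measurableType d) (R : realType)
    (m1 m2 : {measure set T -> \bar R}) :=
  Measure.copy (measure_add m1 m2)
    (msum (fun n => if n is 0%N then m1 else m2) 2).

Lemma measure_add_fin d (T : measurableType d) (R : realType)
    (m1 m2 : {finite_measure set T -> \bar R}) :
  fin_num_fun (measure_add m1 m2).
Proof.
by move=> A mA; rewrite measure_addE fin_numD !fin_num_measure.
Qed.

HB.instance Definition _ d (T : measurableType d) (R : realType)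
    (m1 m2 : {finite_measure set T -> \bar R}) :=
  Measure_isFinite.Build _ _ _ (measure_add m1 m2) (measure_add_fin m1 m2).

(* log (dQ/dP) as the logarithm of the ratio q / p of the densities of Q and P
   with respect to P + Q, so that neither measure is required to dominate the
   other.  It is extended-real-valued: +oo where q > p = 0, and -oo where
   q = 0. *)
Definition log_likelihood_ratio d (T : measurableType d) (R : realType)
    (Q P : probability T R) (x : T) : \bar R :=
  lne (Radon_Nikodym (charge_of_finite_measure Q) (measure_add P Q) x /
       Radon_Nikodym (charge_of_finite_measure P) (measure_add P Q) x)%E.

(* [normal_prob m 0] is not the point mass at m, hence the case split. *)
Definition normal1 (R : realType) (m v : R) (A : set R) : \bar R :=
  if v == 0 then \d_m A else normal_prob m (Num.sqrt v) A.

(* The possibly degenerate k-variate normal law with mean m and covariance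
   matrix V: every linear form y |-> u'y has law N(u'm, u'Vu). *)
Definition mvnormal (R : realType) (k : nat)
    (N : {measure set 'cV[R]_k -> \bar R}) (m : 'cV[R]_k) (V : 'M[R]_k) : Prop :=
  V^T = V /\
  forall u : 'cV[R]_k, 0 <= (u^T *m V *m u) 0 0 /\
    forall A : set R, measurable A ->
      N [set y | A ((u^T *m y) 0 0)] =
      normal1 ((u^T *m m) 0 0) ((u^T *m V *m u) 0 0) A.

(* The chi-square law with l degrees of freedom is that of the squared norm of
   a standard normal l-vector.  The quantile is unique for 0 < beta < 1 and
   0 < l. *)
Definition chi2_quantile (R : realType) (l : nat) (beta : R) : R :=
  xget 0 [set q | exists N : probability 'cV[R]_l R,
    mvnormal N 0 1%:M /\ N [set y | sqnorm y <= q] = beta%:E].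

Definition oP1 (R : realType) (d : nat -> measure_display)
    (X : forall n, measurableType (d n)) (P : forall n, probability (X n) R)
    (V : forall n, X n -> \bar R) : Prop :=
  forall e : R, 0 < e ->
    P n [set x | (e%:E < `|V n x|)%E] @[n --> \oo] --> 0%E.

Definition oP1_vec (R : realType) (d : nat -> measure_display)
    (X : forall n, measurableType (d n)) (P : forall n, probability (X n) R)
    (k : nat) (V : forall n, X n -> 'cV[R]_k) : Prop :=
  oP1 P (fun n x => (enorm (V n x))%:E).

(* The law of [Y n] under [P n] converges weakly to the law of [W] under [Q]. *)
Definition weak_cvg (R : realType) (d : nat -> measure_display)
    (X : forall n, measurableType (d n)) (P : forall n, probability (X n) R)
    (k : nat) (Y : forall n, X n -> 'cV[R]_k)
    d' (T : measurableType d') (Q : probability T R) (W : T -> 'cV[R]_k) : Prop :=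
  forall f : 'cV[R]_k -> R, continuous f -> bounded_fun f ->
    (\int[P n]_x (f (Y n x))%:E)%E @[n --> \oo] --> (\int[Q]_w (f (W w))%:E)%E.

Definition asymp_normal (R : realType) (d : nat -> measure_display)
    (X : forall n, measurableType (d n)) (P : forall n, probability (X n) R)
    (k : nat) (Y : forall n, X n -> 'cV[R]_k) (m : 'cV[R]_k) (V : 'M[R]_k) : Prop :=
  exists N : probability 'cV[R]_k R, mvnormal N m V /\ weak_cvg P Y N id.

(* The regular conditional law of [Z] given [D = y] is N(m y, V y). *)
Definition cond_normal (R : realType) d (T : measurableType d)
    (Q : probability T R) (k l : nat) (Z : T -> 'cV[R]_k) (D : T -> 'cV[R]_l)
    (m : 'cV[R]_l -> 'cV[R]_k) (V : 'cV[R]_l -> 'M[R]_k) : Prop :=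
  exists K : R.-pker 'cV[R]_l ~> 'cV[R]_k,
    (forall y, mvnormal (K y) (m y) (V y)) /\
    forall (A : set 'cV[R]_k) (B : set 'cV[R]_l), measurable A -> measurable B ->
      Q (Z @^-1` A `&` D @^-1` B) = (\int[Q]_(w in D @^-1` B) K (D w) A)%E.

Definition constraint_set (R : realType) (p r : nat) (Upsilon : 'M[R]_(p, r))
    (Theta : set 'cV[R]_p) : set 'cV[R]_p :=
  range (fun b : 'cV[R]_r => Upsilon *m b) `&` Theta.

(* Only the values of [P n], [Delta n], [Gamma] at points of [Theta] matter. *)
Record ULAN (R : realType) (p : nat) (d : nat -> measure_display)
    (X : forall n, measurableType (d n))
    (P : forall n, 'cV[R]_p -> probability (X n) R) (Theta : set 'cV[R]_p)
    (nu : nat -> 'M[R]_p) (Delta : forall n, 'cV[R]_p -> {mfun X n >-> 'cV[R]_p})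
    (Gamma : 'cV[R]_p -> 'M[R]_p) : Prop := {
  ulan_nu_full_rank : forall n, nu n \in unitmx;
  ulan_nu_cvg0 : nu @ \oo --> (0 : 'M[R]_p);
  ulan_expansion : forall (theta : 'cV[R]_p) (thetan taun : nat -> 'cV[R]_p),
    Theta theta -> (forall n, Theta (thetan n)) ->
    bounded_fun (fun n => invmx (nu n) *m (thetan n - theta)) ->
    bounded_fun taun ->
    (forall n, Theta (thetan n + nu n *m taun n)) ->
    oP1 (fun n => P n theta) (fun n x =>
      let quadratic := ((taun n)^T *m Delta n (thetan n) x) 0 0
        - 2^-1 * ((taun n)^T *m Gamma theta *m taun n) 0 0 in
      (log_likelihood_ratio (P n (thetan n + nu n *m taun n)%R) (P n (thetan n)) x
        - quadratic%:E)%E);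
  ulan_central_sequence : forall theta : 'cV[R]_p, Theta theta ->
    asymp_normal (fun n => P n theta) (fun n => Delta n theta) 0 (Gamma theta)
}.

Record estimators_and_test (R : realType) (p r : nat)
    (d : nat -> measure_display) (X : forall n, measurableType (d n))
    (P : forall n, 'cV[R]_p -> probability (X n) R) (Theta : set 'cV[R]_p)
    (Upsilon : 'M[R]_(p, r)) (alpha : R) (nu : nat -> 'M[R]_p)
    (Delta : forall n, 'cV[R]_p -> {mfun X n >-> 'cV[R]_p})
    (Gamma : 'cV[R]_p -> 'M[R]_p)
    (thetaU thetaC : forall n, {mfun X n >-> 'cV[R]_p})
    (phi : forall n, X n -> bool) (D : forall n, {mfun X n >-> 'cV[R]_p})
    (S : forall n, 'cV[R]_p -> {mfun X n >-> 'cV[R]_p})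
    (Sigma Omega A : 'cV[R]_p -> 'M[R]_p) (B : 'cV[R]_p -> 'M[R]_(r, p))
    (C : 'cV[R]_p -> 'M[R]_p) : Prop := {
  et_joint : forall theta, Theta theta ->
    asymp_normal (fun n => P n theta)
      (fun n x => col_mx (S n theta x) (Delta n theta x)) 0
      (block_mx (Sigma theta) (Omega theta) (Omega theta)^T (Gamma theta));
  et_unconstrained : forall theta, Theta theta ->
    oP1_vec (fun n => P n theta) (fun n x =>
      invmx (nu n) *m (thetaU n x - theta) - A theta *m S n theta x);
  et_constrained : forall theta, constraint_set Upsilon Theta theta ->
    oP1_vec (fun n => P n theta) (fun n x =>
      invmx (nu n) *m (thetaC n x - theta)
      - Upsilon *m B theta *m S n theta x);
  et_test : forall n x,
    phi n x = (chi2_quantile (p - r) (1 - alpha) < sqnorm (D n x));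
  et_level : forall theta, constraint_set Upsilon Theta theta ->
    P n theta [set x | phi n x] @[n --> \oo] --> alpha%:E;
  et_statistic : forall theta, constraint_set Upsilon Theta theta ->
    oP1_vec (fun n => P n theta) (fun n x => D n x - C theta *m S n theta x);
  et_idempotent : forall theta, constraint_set Upsilon Theta theta ->
    Sigma theta *m (C theta)^T *m C theta *m Sigma theta
      *m (C theta)^T *m C theta *m Sigma theta
    = Sigma theta *m (C theta)^T *m C theta *m Sigma theta;
  et_trace : forall theta, constraint_set Upsilon Theta theta ->
    \tr ((C theta)^T *m C theta *m Sigma theta) = (p - r)%:R;
  et_consistency : forall theta, (Theta `\` constraint_set Upsilon Theta) theta ->
    P n theta [set x | chi2_quantile (p - r) (1 - alpha) < sqnorm (D n x)]
      @[n --> \oo] --> 1%E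
}.

Definition pte (R : realType) (p : nat) (T : Type) (phi : T -> bool)
    (thetaU thetaC : T -> 'cV[R]_p) (x : T) : 'cV[R]_p :=
  (phi x)%:R *: thetaU x + (~~ phi x)%:R *: thetaC x.

Definition lambda (R : realType) (p r : nat) (alpha v : R) : R :=
  (v <= chi2_quantile (p - r) (1 - alpha))%R%:R.

Definition mu_pte (R : realType) (p r : nat) (alpha : R) (Upsilon : 'M[R]_(p, r))
    (Sigma Omega A : 'M[R]_p) (B : 'M[R]_(r, p)) (C : 'M[R]_p)
    (tau D : 'cV[R]_p) : 'cV[R]_p :=
  let lam := lambda p r alpha (sqnorm D) in
  (1 - lam) *: ((A *m Omega - 1%:M) *m tau
    + A *m Sigma *m C^T *m mpinv (C *m Sigma *m C^T) *m (D - C *m Omega *m tau))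
  + lam *: ((Upsilon *m B *m Omega - 1%:M) *m tau
    + Upsilon *m B *m Sigma *m C^T *m mpinv (C *m Sigma *m C^T)
        *m (D - C *m Omega *m tau)).

Definition Gamma_pte (R : realType) (p r : nat) (alpha : R)
    (Upsilon : 'M[R]_(p, r)) (Sigma A : 'M[R]_p) (B : 'M[R]_(r, p)) (C : 'M[R]_p)
    (D : 'cV[R]_p) : 'M[R]_p :=
  let lam := lambda p r alpha (sqnorm D) in
  let L := Sigma *m C^T *m mpinv (C *m Sigma *m C^T) *m C *m Sigma in
  (1 - lam) *: (A *m (Sigma - L) *m A^T)
  + lam *: (Upsilon *m B *m (Sigma - L) *m B^T *m Upsilon^T).

(* Main.v *)
Require Import Defs.
From HB Require Import structures.
From mathcomp Require Import all_boot all_order all_algebra.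
From mathcomp Require Import all_classical all_reals all_analysis.
From mathcomp Require Import measurable_realfun.
From mathcomp Require Import ring lra.
Set Implicit Arguments.
Unset Strict Implicit.
Unset Printing Implicit Defensive.
Import Order.TTheory GRing.Theory Num.Theory.
Import numFieldNormedType.Exports.
Local Open Scope classical_set_scope.
Local Open Scope ring_scope.

(** Under P_theta the score S and the central sequence Delta have a joint
Gaussian limit N, while the rescaled errors of the two estimators and the test
statistic are linear in S up to vanishing remainders.  The rescaled error of
the preliminary test estimator, paired with the statistic, is thus a function
of (S, Delta), of tau_n - tau and of the remainders, whose only discontinuities
lie where the squared norm of the test statistic equals the critical value.

The passage from P_theta to the local alternatives is Le Cam's third lemma.
Only lower bounds on expectations of nonnegative functions are carried through
the argument: lower semicontinuous functions suffice for them
([liminf_mapping]), and the likelihood ratio may be truncated and restricted to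
the event where its expansion holds, which loses mass in one direction only
([lr_lower_bound], [lecam_liminf], [lecam_pte]).  Since the limiting weight
exp(tau' delta - tau' Gamma tau / 2) has N-integral one, no mass is lost
in the limit, and the lower bounds for K + f and K - f give weak convergence
([weak_cvg_liminf]).  The discontinuity set is N-null because C_theta S has a
nonzero Gaussian limit: in a suitable direction the squared norm is a
nonconstant quadratic polynomial of an independent normal variable
([gaussian_sphere0]); the trace condition, with p - r > 0, is what makes the
limit nonzero.

It remains to recognise the law of the pair (S, C_theta S) under the weighted
Gaussian law.  Its moment generating function is that of a pair simulated
in two independent steps: a test statistic y, then the regression of the score
on y plus an independent Gaussian residual ([tilted_score_test]).  A measure on
R^k is determined by its moment generating function ([mgf_unique]), so the two
laws agree.  In the simulated pair the conditional law given y is the law of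
an affine function of the residual, hence normal ([limit_pte_mvnormal]), and
the sign of |y|^2 - c only selects which of the two affine functions is used. *)

(** * Borel measurability of matrix-valued functions *)
Section MatrixMeasurability.
Context {R : realType}.

(** An open set of matrices is the union of the sup-norm balls with rational
centre and radius 1/(k+1) that it contains; there are countably many of them,
and each is defined by finitely many conditions on the entries. *)
Lemma measurable_fun_mx d (T : measurableType d) m n (f : T -> 'M[R]_(m, n)) :
  (forall i j, measurable_fun setT (fun x => f x i j)) -> measurable_fun setT f.
Proof.
move=> mf; apply: (@measurability _ _ T _ setT f (@open 'M[R]_(m, n))) => //.
move=> _ [U oU <-]; rewrite setTI.
pose c (q : 'M[rat]_(m, n)) : 'M[R]_(m, n) := map_mx ratr q.
pose r (k : nat) : R := k.+1%:R^-1.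
have r0 k : 0 < r k by rewrite invr_gt0.
(* The ball of index t when it lies in U, and nothing otherwise. *)
pose F (t : 'M[rat]_(m, n) * nat) : set T :=
  if `[< ball (c t.1) (r t.2) `<=` U >] then f @^-1` ball (c t.1) (r t.2) else set0.
have -> : f @^-1` U = \bigcup_t F t.
  apply/seteqP; split=> [x Ufx|x [t _]]; last first.
    by rewrite /F; case: ifPn => // /asboolP sU; exact: sU.
  have /nbhs_ballP[e /= e0 eU] : nbhs (f x) U by apply: open_nbhs_nbhs.
  have [k ke] : exists k, r k < e / 2.
    have e20 : 0 < e / 2 by rewrite divr_gt0.
    by have [k _ /(_ k (leqnn k))] := near_infty_natSinv_lt (PosNum e20); exists k.
  have rat_near (ij : 'I_m * 'I_n) : exists q : rat, `|f x ij.1 ij.2 - ratr q| < r k.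
    have : f x ij.1 ij.2 - r k < f x ij.1 ij.2 + r k by rewrite ltrBlDr -addrA ltrDl addr_gt0.
    by move=> /rat_in_itvoo[q]; rewrite in_itv/= => qr; exists q; rewrite distrC ltr_distl.
  have [g Hg] := choice rat_near.
  pose q : 'M[rat]_(m, n) := \matrix_(i, j) g (i, j).
  exists (q, k) => //; rewrite /F /=; case: ifPn => [_|/asboolP]; last first.
    case=> y [_ qy]; apply: eU; split => // i j.
    have := qy i j; rewrite /c !mxE => qyij.
    rewrite /ball/= in qyij *; rewrite (le_lt_trans (ler_distD (ratr (g (i, j))) _ _))//.
    have := Hg (i, j) => /= Hij.
    rewrite (splitr e) ltrD// (lt_trans _ ke)//.
  split => // i j; rewrite /c !mxE /ball/= distrC; exact: (Hg (i, j)).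
apply: countable_bigcupT_measurable; first exact: countableP.
move=> t; rewrite /F; case: ifPn => // _.
have -> : f @^-1` ball (c t.1) (r t.2) =
    \bigcap_(ij in [set: 'I_m * 'I_n]) [set x | `|c t.1 ij.1 ij.2 - f x ij.1 ij.2| < r t.2].
  apply/seteqP; split=> [x [_ h] ij _|x h]; first exact: h.
  by split=> // i j; exact: (h (i, j)).
apply: fin_bigcap_measurable => // ij _.
rewrite -[X in measurable X]setTI.
apply: measurable_fun_ltr => //.
by apply: measurableT_comp => //; apply: measurable_funB.
Qed.

Lemma continuous_measurable_mx m n (f : 'M[R]_(m, n) -> R) :
  continuous f -> measurable_fun setT f.
Proof.
move=> /continuousP cf; apply: (measurability _ (RGenOpens.measurableE R)).
move=> _ [_ [a [b ->] <-]]; rewrite setTI; apply: sub_gen_smallest.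
by apply: cf; exact: interval_open.
Qed.

Lemma measurable_coord m n i j : measurable_fun setT (fun M : 'M[R]_(m, n) => M i j).
Proof. by apply: continuous_measurable_mx; exact: coord_continuous. Qed.

Section Composition.
Context d (T : measurableType d).

Lemma measurable_entry m n (f : T -> 'M[R]_(m, n)) i j :
  measurable_fun setT f -> measurable_fun setT (fun x => f x i j).
Proof. by move=> mf; apply: (measurableT_comp (measurable_coord i j)). Qed.

Lemma measurable_mulmxl m n k (M : 'M[R]_(m, n)) (f : T -> 'M[R]_(n, k)) :
  measurable_fun setT f -> measurable_fun setT (fun x => M *m f x).
Proof.
move=> mf; apply: measurable_fun_mx => i j.
under eq_fun do rewrite mxE.
apply: measurable_sum => l; apply: measurable_funM => //.
exact: measurable_entry.
Qed.

Lemma measurable_addmx m n (f g : T -> 'M[R]_(m, n)) :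
  measurable_fun setT f -> measurable_fun setT g ->
  measurable_fun setT (fun x => f x + g x).
Proof.
move=> mf mg; apply: measurable_fun_mx => i j; under eq_fun do rewrite mxE.
by apply: measurable_funD; exact: measurable_entry.
Qed.

Lemma measurable_subcst m n (f : T -> 'M[R]_(m, n)) (M : 'M[R]_(m, n)) :
  measurable_fun setT f -> measurable_fun setT (fun x => f x - M).
Proof. by move=> mf; apply: measurable_addmx. Qed.

Lemma measurable_submx m n (f g : T -> 'M[R]_(m, n)) :
  measurable_fun setT f -> measurable_fun setT g ->
  measurable_fun setT (fun x => f x - g x).
Proof.
move=> mf mg; apply: measurable_fun_mx => i j; under eq_fun do rewrite !mxE.
by apply: measurable_funB; exact: measurable_entry.
Qed.

Lemma measurable_col_mx m1 m2 n (f : T -> 'M[R]_(m1, n)) (g : T -> 'M[R]_(m2, n)) :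
  measurable_fun setT f -> measurable_fun setT g ->
  measurable_fun setT (fun x => col_mx (f x) (g x)).
Proof.
move=> mf mg; apply: measurable_fun_mx => i j.
case: (split_ordP i) => l ->.
  by under eq_fun do rewrite col_mxEu; exact: measurable_entry.
by under eq_fun do rewrite col_mxEd; exact: measurable_entry.
Qed.

Lemma measurable_usubmx m1 m2 n (f : T -> 'M[R]_(m1 + m2, n)) :
  measurable_fun setT f -> measurable_fun setT (fun x => usubmx (f x)).
Proof.
move=> mf; apply: measurable_fun_mx => i j; under eq_fun do rewrite mxE.
exact: measurable_entry.
Qed.

Lemma measurable_dsubmx m1 m2 n (f : T -> 'M[R]_(m1 + m2, n)) :
  measurable_fun setT f -> measurable_fun setT (fun x => dsubmx (f x)).
Proof.
move=> mf; apply: measurable_fun_mx => i j; under eq_fun do rewrite mxE.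
exact: measurable_entry.
Qed.

Lemma measurable_sqnorm k (f : T -> 'cV[R]_k) :
  measurable_fun setT f -> measurable_fun setT (fun x => sqnorm (f x)).
Proof.
move=> mf; rewrite /sqnorm; under eq_fun do rewrite mxE.
apply: measurable_sum => l; under eq_fun do rewrite mxE.
by apply: measurable_funM; exact: measurable_entry.
Qed.

Lemma measurable_norm_mx m n (f : T -> 'M[R]_(m, n)) :
  measurable_fun setT f -> measurable_fun setT (fun x => `|f x|).
Proof.
move=> mf; apply: (measurableT_comp (f := fun M : 'M[R]_(m, n) => `|M|)) => //.
by apply: continuous_measurable_mx => M; exact: norm_continuous.
Qed.

End Composition.

End MatrixMeasurability.

(** * A finite moment generating function determines the measure *)
Section Agree.
Context {R : realType} d {T : measurableType d}.
Variables m1 m2 : {measure set T -> \bar R}.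

(** Integrability is part of the definition so that agreement passes to linear
combinations and to dominated limits. *)
Definition agree (f : T -> R) : Prop :=
  [/\ m1.-integrable setT (EFin \o f), m2.-integrable setT (EFin \o f) &
      \int[m1]_x f x = \int[m2]_x f x].

Lemma agreeZ (c : R) f : agree f -> agree (fun x => c * f x).
Proof.
move=> [i1 i2 e]; split.
- by have := integrableZl measurableT c i1; apply: eq_integrable => // x _; rewrite /= EFinM.
- by have := integrableZl measurableT c i2; apply: eq_integrable => // x _; rewrite /= EFinM.
- by rewrite !RintegralZl// e.
Qed.

Lemma agreeD f g : agree f -> agree g -> agree (fun x => f x + g x).
Proof.
move=> [i1 i2 e] [j1 j2 e']; split.
- by have := integrableD measurableT i1 j1; apply: eq_integrable => // x _; rewrite /= EFinD.
- by have := integrableD measurableT i2 j2; apply: eq_integrable => // x _; rewrite /= EFinD.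
- by rewrite !RintegralD// e e'.
Qed.

Lemma agree_sum I (s : seq I) (F : I -> T -> R) :
  (forall i, agree (F i)) -> agree (fun x => \sum_(i <- s) F i x).
Proof.
move=> aF; elim: s => [|i s IHs].
  under eq_fun do rewrite big_nil.
  split; [exact: integrable0|exact: integrable0|by rewrite !Rintegral_cst// !mul0r].
by under eq_fun do rewrite big_cons; exact: agreeD.
Qed.

Lemma dominated_Rintegral (mu : {measure set T -> \bar R}) (f_ : nat -> T -> R) (f g : T -> R) :
  (forall n, measurable_fun setT (f_ n)) ->
  mu.-integrable setT (EFin \o g) ->
  (forall n x, `|f_ n x| <= g x) ->
  (forall x, f_ n x @[n --> \oo] --> f x) ->
  mu.-integrable setT (EFin \o f) /\
  \int[mu]_x f_ n x @[n --> \oo] --> \int[mu]_x f x.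
Proof.
move=> mf ig fg cf.
have mlim : measurable_fun setT f by apply: (measurable_fun_cvg mf) => x _; exact: cf.
have [//|||//||fi _ fl] := @dominated_convergence _ _ R mu setT measurableT
  (fun n => EFin \o f_ n) (EFin \o f) (EFin \o g).
- by move=> n; exact/measurable_EFinP.
- exact/measurable_EFinP.
- by apply: aeW => x _; apply: cvg_EFin; [exact: nearW|exact: cf].
- by apply: aeW => x n _; rewrite /= lee_fin.
split=> //; rewrite /Rintegral.
by apply: fine_cvg; rewrite fineK//; exact: integrable_fin_num.
Qed.

Lemma agree_lim (f_ : nat -> T -> R) f g :
  (forall n, agree (f_ n)) -> agree g ->
  (forall n x, `|f_ n x| <= g x) ->
  (forall x, f_ n x @[n --> \oo] --> f x) -> agree f.
Proof.
move=> af [g1 g2 _] fg cf.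
have mf n : measurable_fun setT (f_ n).
  by have [/measurable_int/measurable_EFinP] := af n.
have [i1 l1] := dominated_Rintegral mf g1 fg cf.
have [i2 l2] := dominated_Rintegral mf g2 fg cf.
split=> //; apply: (cvg_unique _ l1) => //.
suff -> : (fun n => \int[m1]_x f_ n x) = (fun n => \int[m2]_x f_ n x) by [].
by apply/funext => n; have [_ _] := af n.
Qed.

End Agree.

Section Analytic.
Context {R : realType}.

Lemma bernoulli_ineq (x : R) n : 0 <= x -> 1 + n%:R * x <= (1 + x) ^+ n.
Proof.
move=> x0; elim: n => [|n IHn]; first by rewrite mul0r addr0 expr0.
rewrite exprS; apply: (@le_trans _ _ ((1 + x) * (1 + n%:R * x))); last first.
  by rewrite ler_wpM2l// addr_ge0.
rewrite -natr1 -subr_ge0 (_ : _ - _ = n%:R * x ^+ 2); last by ring.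
by rewrite mulr_ge0// sqr_ge0.
Qed.

Lemma expR_diffquot (x h : R) : 0 < h ->
  x <= (expR (h * x) - 1) / h <= x * expR (h * x).
Proof.
move=> h0; rewrite ler_pdivlMr// ler_pdivrMr//; apply/andP; split.
  by rewrite mulrC lerBrDl expR_ge1Dx.
have := expR_ge1Dx (- (h * x)); rewrite -(ler_pM2r (expR_gt0 (h * x))).
by rewrite -expRD addNr expR0; lra.
Qed.

Lemma ler_norm_expR (x : R) : `|x| <= expR `|x|.
Proof. by apply: le_trans (expR_ge1Dx _); rewrite lerDr. Qed.

Lemma expR_norm_le (x : R) : expR `|x| <= expR x + expR (- x).
Proof. by case: (ger0P x) => _; rewrite ?lerDl ?lerDr expR_ge0. Qed.

(** The bound does not depend on h; it dominates the limit h -> 0 that recovers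
powers of x from exponentials. *)
Lemma expR_diffquot_bound (x h : R) : 0 < h <= 1 ->
  `|(expR (h * x) - 1) / h| <= expR (2 * `|x|).
Proof.
move=> /andP[h0 h1]; have /andP[l u] := expR_diffquot x h0.
have xe : `|x| * expR `|x| <= expR (2 * `|x|).
  by rewrite mulr_natl mulr2n expRD ler_wpM2r ?expR_ge0 ?ler_norm_expR.
have x1 : `|x| <= `|x| * expR `|x|.
  by rewrite ler_peMr// -expR0 ler_expR.
have hx : expR (h * x) <= expR `|x|.
  rewrite ler_expR (le_trans (ler_norm _))// normrM gtr0_norm//.
  by rewrite ler_piMl.
have ux : x * expR (h * x) <= `|x| * expR `|x|.
  apply: (@le_trans _ _ (`|x| * expR (h * x))).
    by rewrite ler_wpM2r ?expR_ge0 ?ler_norm.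
  by rewrite ler_wpM2l.
rewrite ler_norml; apply/andP; split.
  by have := ler_norm (- x); rewrite normrN; lra.
by lra.
Qed.

Lemma expR_diffquot_cvg (x : R) :
  (expR (n.+1%:R^-1 * x) - 1) / n.+1%:R^-1 @[n --> \oo] --> x.
Proof.
have h0 n : 0 < n.+1%:R^-1 :> R by rewrite invr_gt0.
apply: (@squeeze_cvgr _ _ _ _ (cst x) (fun n => x * expR (n.+1%:R^-1 * x))).
- by apply: nearW => n; exact: expR_diffquot.
- exact: cvg_cst.
- have hx : n.+1%:R^-1 * x @[n --> \oo] --> 0 * x.
    by apply: cvgMl; exact: cvg_harmonic.
  have ehx : expR (n.+1%:R^-1 * x) @[n --> \oo] --> expR (0 * x).
    exact: (cvg_comp _ _ hx (@continuous_expR R (0 * x))).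
  rewrite mul0r expR0 in ehx.
  by rewrite -[X in _ --> X]mulr1; apply: cvgMr.
Qed.

Lemma norm_series_le_expR (c : nat -> R) (x : R) n :
  (forall i, `|c i| <= `|x| ^+ i / i`!%:R) -> `|series c n| <= expR `|x|.
Proof.
move=> cx; rewrite seriesEnat/=.
apply: (le_trans (ler_norm_sum _ _ _)).
apply: (@le_trans _ _ (series (exp_coeff `|x|) n)).
  by rewrite seriesEnat/=; apply: ler_sum => i _; exact: cx.
apply: nondecreasing_cvgn_le; last exact: is_cvg_series_exp_coeff.
by apply: nondecreasing_series => i _ _; exact: exp_coeff_ge0.
Qed.

Lemma norm_cos_coeff (x : R) i : `|cos_coeff x i| <= `|x| ^+ i / i`!%:R.
Proof.
rewrite /cos_coeff !normrM normfV normr_nat normrX normrX normrN1 expr1n mulr1.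
rewrite [X in _ / X]ger0_norm//.
rewrite ler_wpM2r ?invr_ge0// ler_piMl ?exprn_ge0//.
by case: (~~ odd i).
Qed.

Lemma norm_sin_coeff (x : R) i : `|sin_coeff x i| <= `|x| ^+ i / i`!%:R.
Proof.
rewrite /sin_coeff !normrM normfV normr_nat normrX normrX normrN1 expr1n mulr1.
rewrite [X in _ / X]ger0_norm//.
rewrite ler_wpM2r ?invr_ge0// ler_piMl ?exprn_ge0//.
by case: (odd i).
Qed.

Lemma cvg_nXexp (x : R) : 0 <= x < 1 -> n%:R * x ^+ n @[n --> \oo] --> 0.
Proof.
move=> /andP[x0 x1]; pose y := Num.sqrt x.
have xy : x = y * y by rewrite -expr2 sqr_sqrtr.
have y0 : 0 <= y by exact: sqrtr_ge0.
have y1 : y < 1 by rewrite -sqrtr1 ltr_sqrt.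
have [yz|yN0] := eqVneq y 0.
  rewrite (_ : (fun _ => _) = cst 0); first exact: cvg_cst.
  apply/funext => -[|n]; first by rewrite mul0r.
  by rewrite xy yz mulr0 expr0n mulr0.
have yp : 0 < y by rewrite lt_neqAle eq_sym yN0.
have a0 : 0 < y^-1 - 1 by rewrite subr_gt0 invf_gt1.
apply: (@squeeze_cvgr _ _ _ _ (cst 0) (fun n => (y^-1 - 1)^-1 * y ^+ n)).
- apply: nearW => n; rewrite mulr_ge0 ?exprn_ge0//= xy exprMn mulrA.
  rewrite ler_wpM2r ?exprn_ge0// -ler_pdivlMr ?exprn_gt0//.
  rewrite -ler_pdivrMl ?invr_gt0// invrK.
  have := @bernoulli_ineq (y^-1 - 1) n (ltW a0).
  by rewrite (_ : 1 + (y^-1 - 1) = y^-1) ?exprVn; [lra|ring].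
- exact: cvg_cst.
- rewrite -[X in _ --> X](mulr0 (y^-1 - 1)^-1); apply: cvgMr.
  by apply: cvg_expr; rewrite ger0_norm.
Qed.

(** Polynomials that map [0, 1] to itself and converge pointwise there to the
indicator of [0, 1/2[: step_poly n g is roughly exp(- n (2 g)^n). *)
Definition step_poly n (g : R) : R := (1 - g ^+ n) ^+ (n * 2 ^ n).

Lemma step_poly01 n g : 0 <= g <= 1 -> 0 <= step_poly n g <= 1.
Proof.
move=> /andP[g0 g1]; rewrite /step_poly exprn_ge0 ?exprn_ile1//.
- by rewrite subr_ge0 exprn_ile1.
- by rewrite gerBl exprn_ge0.
- by rewrite subr_ge0 exprn_ile1.
Qed.

Lemma step_poly_cvg g : 0 <= g <= 1 ->
  step_poly n g @[n --> \oo] --> ((g < 2^-1)%R%:R : R).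
Proof.
move=> /andP[g0 g1].
have gn n : 0 <= g ^+ n <= 1 by rewrite exprn_ge0 ?exprn_ile1.
have [glt|gge] := ltP g 2^-1.
  apply: (@squeeze_cvgr _ _ _ _ (fun n => 1 - n%:R * (2 * g) ^+ n) (cst 1)).
  - apply: nearW => n; have g01 : 0 <= g <= 1 by rewrite g0.
    have /andP[_ ->] := step_poly01 n g01; rewrite andbT.
    rewrite /step_poly exprMn -natrX mulrA -natrM.
    elim: (n * 2 ^ n)%N => [|m IHm]; first by rewrite mul0r subr0 expr0.
    have /andP[a0 a1] := gn n; set a := g ^+ n in a0 a1 IHm *.
    rewrite exprSr; apply: (@le_trans _ _ ((1 - m%:R * a) * (1 - a))); last first.
      by rewrite ler_wpM2r// subr_ge0.
    rewrite -natr1 -subr_ge0 (_ : _ - _ = m%:R * a ^+ 2); last by ring.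
    by rewrite mulr_ge0// sqr_ge0.
  - rewrite -[X in _ --> X]subr0; apply: cvgB; first exact: cvg_cst.
    by apply: cvg_nXexp; lra.
  - exact: cvg_cst.
apply: (@squeeze_cvgr _ _ _ _ (cst 0) (fun n => n%:R^-1)).
- near=> n; have g01 : 0 <= g <= 1 by rewrite g0.
  have /andP[-> _] /= := step_poly01 n g01.
  have n0 : (0 < n)%N by near: n; exact: nbhs_infty_gt.
  rewrite /step_poly; have /andP[a0 a1] := gn n.
  have ga : (2^-1) ^+ n <= g ^+ n by rewrite lerXn2r// nnegrE// invr_ge0.
  set a := g ^+ n in a0 a1 ga *; set k := (n * 2 ^ n)%N.
  have ka : n%:R <= k%:R * a.
    rewrite natrM -mulrA ler_peMr// natrX.
    apply: (@le_trans _ _ (2 ^+ n * 2^-1 ^+ n)); last by rewrite ler_wpM2l// exprn_ge0.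
    by rewrite -exprMn divff// expr1n.
  (* (1 - a)^k <= 1 / (1 + a)^k <= 1 / (1 + k a) by Bernoulli, and k a >= n. *)
  have : (1 - a) ^+ k * (1 + a) ^+ k <= 1.
    by rewrite -exprMn exprn_ile1//; [rewrite mulr_ge0//; lra|nra].
  have := bernoulli_ineq k a0 => b1 b2.
  have p0 : 0 <= (1 - a) ^+ k by rewrite exprn_ge0// subr_ge0.
  have b3 : (1 - a) ^+ k * n%:R <= 1.
    apply: le_trans b2; rewrite ler_wpM2l//; apply: le_trans b1; lra.
  by rewrite -[leRHS]mul1r ler_pdivlMr// ltr0n.
- exact: cvg_cst.
- by rewrite -cvg_shiftS; exact: cvg_harmonic.
Unshelve. all: by end_near.
Qed.

Lemma cvg_prod_seq (I : Type) (s : seq I) (f_ : nat -> I -> R) (f : I -> R) :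
  (forall i, f_ n i @[n --> \oo] --> f i) ->
  \prod_(i <- s) f_ n i @[n --> \oo] --> \prod_(i <- s) f i.
Proof.
move=> cf; elim: s => [|i s IHs].
  by rewrite big_nil; under eq_fun do rewrite big_nil; exact: cvg_cst.
by rewrite big_cons; under eq_fun do rewrite big_cons; exact: cvgM.
Qed.

Lemma sin_lt0 (x : R) : - pi < x < pi -> (sin x < 0) = (x < 0).
Proof.
move=> /andP[l u]; have [x0|x0|->] := ltgtP x 0.
- by rewrite -oppr_gt0 -sinN sin_gt0_pi// oppr_gt0 x0/= ltrNl.
- by apply/negbTE; rewrite -leNgt ltW// sin_gt0_pi// x0.
- by rewrite sin0 ltxx.
Qed.

(** The sign of the sine is that of its argument only on ]-pi, pi[, hence the
rescaling: every point is eventually brought into that interval. *)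
Lemma cvg_sin_scale (x : R) :
  ((sin (n.+1%:R^-1 * x) < 0)%R%:R : R) @[n --> \oo] --> ((x < 0)%R%:R : R).
Proof.
apply: cvg_near_cst.
have : n.+1%:R^-1 * x @[n --> \oo] --> 0 * x by apply: cvgMl; exact: cvg_harmonic.
rewrite mul0r => /cvgrPdist_lt /(_ _ (pi_gt0 R)); apply: filterS => n.
rewrite sub0r normrN ltr_norml => h.
by rewrite sin_lt0// pmulr_rlt0// invr_gt0.
Qed.

End Analytic.

Section MgfUniqueness.
Context {R : realType}.

Section Line.
Context d {T : measurableType d}.
Variables (m1 m2 : {measure set T -> \bar R}) (X : T -> R).
Hypothesis agX : forall t, agree m1 m2 (fun y => expR (t * X y)).

Let agree_dom n : agree m1 m2 (fun y => expR (n * X y) + expR (- n * X y)).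
Proof. by apply: agreeD; exact: agX. Qed.

(** x^n is the limit of ((e^(hx) - 1) / h)^n, a combination of exponentials,
as h tends to 0, dominated by exp(2 n |x|). *)
Lemma agree_moment n : agree m1 m2 (fun y => X y ^+ n).
Proof.
pose h (j : nat) : R := j.+1%:R^-1.
apply: (@agree_lim _ _ _ _ _ (fun j y => ((expR (h j * X y) - 1) / h j) ^+ n) _
  (fun y => expR ((2 * n%:R) * X y) + expR (- (2 * n%:R) * X y))) => //.
- move=> j.
  rewrite (_ : (fun _ => _) = (fun y => \sum_(i < n.+1)
    ((h j ^- n * (-1) ^+ i) *+ 'C(n, i)) * expR (((n - i)%:R * h j) * X y))).
    by apply: agree_sum => i; apply: agreeZ; exact: agX.
  apply/funext => y; rewrite exprMn exprBn mulr_suml; apply: eq_bigr => i _.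
  by rewrite expr1n mulr1 -mulrA expRM_natl exprVn !mulrnAl; congr (_ *+ _); ring.
- move=> j y; rewrite normrX.
  have h01 : 0 < h j <= 1 by rewrite invr_gt0 ltr0n invf_le1 ?ler1n.
  apply: (@le_trans _ _ (expR (2 * `|X y|) ^+ n)).
    by rewrite lerXn2r ?nnegrE ?expR_ge0// expR_diffquot_bound.
  rewrite -expRM_natl.
  have -> : n%:R * (2 * `|X y|) = `|2 * n%:R * X y|.
    by rewrite normrM ger0_norm ?mulr_ge0//; ring.
  by rewrite mulNr; exact: expR_norm_le.
- move=> y; elim: n => [|n IHn]; first by rewrite expr0; under eq_fun do rewrite expr0; exact: cvg_cst.
  rewrite exprS; under eq_fun do rewrite exprS.
  by apply: cvgM => //; exact: expR_diffquot_cvg.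
Qed.

Let agree_series (c : nat -> R) (f : R -> R) :
  (forall x i, `|c i * x ^+ i| <= `|x| ^+ i / i`!%:R) ->
  (forall x, series (fun i => c i * x ^+ i) n @[n --> \oo] --> f x) ->
  agree m1 m2 (f \o X).
Proof.
move=> cx cf.
apply: (@agree_lim _ _ _ _ _ (fun n y => series (fun i => c i * X y ^+ i) n) _
  (fun y => expR (1 * X y) + expR (- 1 * X y))) => //.
- move=> n; under eq_fun do rewrite seriesEnat/=.
  by apply: agree_sum => i; apply: agreeZ; exact: agree_moment.
- move=> n y; rewrite mul1r mulN1r; apply: le_trans (expR_norm_le _).
  by apply: norm_series_le_expR => i; exact: cx.
Qed.

Lemma agree_cos_line : agree m1 m2 (cos \o X).
Proof.
apply: (@agree_series (fun i => (~~ odd i)%:R * (-1) ^+ i./2 * (i`!%:R)^-1)).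
- move=> x i; have := norm_cos_coeff x i; congr (`|_| <= _).
  by rewrite /cos_coeff mulrAC.
- move=> x; have -> : (fun i => (~~ odd i)%:R * (-1) ^+ i./2 / i`!%:R * x ^+ i) = cos_coeff x.
    by apply/funext => i; rewrite /cos_coeff mulrAC.
  by rewrite unlock; exact: is_cvg_series_cos_coeff.
Qed.

Lemma agree_sin_line : agree m1 m2 (sin \o X).
Proof.
apply: (@agree_series (fun i => (odd i)%:R * (-1) ^+ i.-1./2 * (i`!%:R)^-1)).
- move=> x i; have := norm_sin_coeff x i; congr (`|_| <= _).
  by rewrite /sin_coeff mulrAC.
- move=> x; have -> : (fun i => (odd i)%:R * (-1) ^+ i.-1./2 / i`!%:R * x ^+ i) = sin_coeff x.
    by apply/funext => i; rewrite /sin_coeff mulrAC.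
  by rewrite unlock; exact: is_cvg_series_sin_coeff.
Qed.

Lemma agree_cos_phase c : agree m1 m2 (fun y => cos (X y + c)).
Proof.
rewrite (_ : (fun _ => _) = fun y => cos c * cos (X y) + (- sin c) * sin (X y)).
  apply: agreeD; apply: agreeZ; [exact: agree_cos_line|exact: agree_sin_line].
by apply/funext => y; rewrite cosD; ring.
Qed.

End Line.

Definition dot k (u y : 'cV[R]_k) : R := (u^T *m y) 0 0.

Lemma dotE k (u y : 'cV[R]_k) : dot u y = \sum_i u i 0 * y i 0.
Proof. by rewrite /dot mxE; apply: eq_bigr => i _; rewrite mxE. Qed.

Lemma dotDl k (u v y : 'cV[R]_k) : dot (u + v) y = dot u y + dot v y.
Proof. by rewrite /dot linearD mulmxDl mxE. Qed.

Lemma dotDr k (u v y : 'cV[R]_k) : dot y (u + v) = dot y u + dot y v.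
Proof. by rewrite /dot mulmxDr mxE. Qed.

Lemma dotZl k c (u y : 'cV[R]_k) : dot (c *: u) y = c * dot u y.
Proof. by rewrite /dot linearZ -scalemxAl mxE. Qed.

Lemma dotNl k (u y : 'cV[R]_k) : dot (- u) y = - dot u y.
Proof. by rewrite /dot linearN mulNmx mxE. Qed.

Lemma dotNr k (u y : 'cV[R]_k) : dot u (- y) = - dot u y.
Proof. by rewrite /dot mulmxN mxE. Qed.

Lemma dot0l k (y : 'cV[R]_k) : dot 0 y = 0.
Proof. by rewrite /dot trmx0 mul0mx mxE. Qed.

Lemma dot0r k (y : 'cV[R]_k) : dot y 0 = 0.
Proof. by rewrite /dot mulmx0 mxE. Qed.

Lemma dotC k (u v : 'cV[R]_k) : dot u v = dot v u.
Proof. by rewrite !dotE; apply: eq_bigr => i _; rewrite mulrC. Qed.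

Lemma dot_mulmx k l (M : 'M[R]_(k, l)) (u : 'cV[R]_k) (y : 'cV[R]_l) :
  dot u (M *m y) = dot (M^T *m u) y.
Proof. by rewrite /dot trmx_mul trmxK mulmxA. Qed.

Lemma dot_delta k i (y : 'cV[R]_k) : dot (delta_mx i 0) y = y i 0.
Proof.
rewrite dotE (bigD1 i)//= big1 ?addr0 => [|j ji]; rewrite mxE eqxx ?andbT.
  by rewrite mul1r.
by rewrite (negbTE ji) mul0r.
Qed.

Lemma measurable_dot d (T : measurableType d) k (u : 'cV[R]_k) (f : T -> 'cV[R]_k) :
  measurable_fun setT f -> measurable_fun setT (fun x => dot u (f x)).
Proof. by move=> mf; apply: measurable_entry; exact: measurable_mulmxl. Qed.

Section TrigPoly.
Variable k : nat.

(** Cosines with arbitrary phases contain the sines and, by the formula for the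
product of two cosines, span a class stable under products. *)
Inductive trig_poly : ('cV[R]_k -> R) -> Prop :=
| trig_cos u c : trig_poly (fun y => cos (dot u y + c))
| trigZ c f : trig_poly f -> trig_poly (fun y => c * f y)
| trigD f g : trig_poly f -> trig_poly g -> trig_poly (fun y => f y + g y).

Lemma trig_cst c : trig_poly (cst c).
Proof.
have := trigZ c (trig_cos 0 0); rewrite (_ : (fun _ => _) = cst c)//.
by apply/funext => y /=; rewrite dot0l addr0 cos0 mulr1.
Qed.

Lemma trigM f g : trig_poly f -> trig_poly g -> trig_poly (fun y => f y * g y).
Proof.
move=> tf; elim: tf g => [u c|c f' _ IH|f1 f2 _ IH1 _ IH2] g tg.
- elim: tg => [v b|b f' _ IH|f1 f2 _ IH1 _ IH2].
  + have -> : (fun y => cos (dot u y + c) * cos (dot v y + b)) =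
      (fun y => 2^-1 * cos (dot (u + v) y + (c + b)) + 2^-1 * cos (dot (u - v) y + (c - b))).
      apply/funext => y; rewrite !dotDl dotNl.
      have -> : dot u y + dot v y + (c + b) = (dot u y + c) + (dot v y + b) by ring.
      have -> : dot u y - dot v y + (c - b) = (dot u y + c) - (dot v y + b) by ring.
      by move: (dot u y + c) (dot v y + b) => p q; rewrite cosD cosB; field.
    by apply: trigD; apply: trigZ; exact: trig_cos.
  + have -> : (fun y => cos (dot u y + c) * (b * f' y)) =
      (fun y => b * (cos (dot u y + c) * f' y)) by apply/funext => y; ring.
    exact: trigZ.
  + have -> : (fun y => cos (dot u y + c) * (f1 y + f2 y)) =
      (fun y => cos (dot u y + c) * f1 y + cos (dot u y + c) * f2 y) by apply/funext => y; ring.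
    exact: trigD.
- have -> : (fun y => c * f' y * g y) = (fun y => c * (f' y * g y)) by apply/funext => y; ring.
  by apply: trigZ; exact: IH.
- have -> : (fun y => (f1 y + f2 y) * g y) = (fun y => f1 y * g y + f2 y * g y) by apply/funext => y; ring.
  by apply: trigD; [exact: IH1|exact: IH2].
Qed.

Lemma trigX f n : trig_poly f -> trig_poly (fun y => f y ^+ n).
Proof.
move=> tf; elim: n => [|n IHn].
  by under eq_fun do rewrite expr0; exact: trig_cst.
by under eq_fun do rewrite exprS; exact: trigM.
Qed.

Lemma trig_prod I (s : seq I) (f : I -> 'cV[R]_k -> R) :
  (forall i, trig_poly (f i)) -> trig_poly (fun y => \prod_(i <- s) f i y).
Proof.
move=> tf; elim: s => [|i s IHs].
  by under eq_fun do rewrite big_nil; exact: trig_cst.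
by under eq_fun do rewrite big_cons; exact: trigM.
Qed.

Lemma trig_step n f : trig_poly f -> trig_poly (fun y => step_poly n (f y)).
Proof.
move=> tf; apply: trigX.
have -> : (fun y => 1 - f y ^+ n) = (fun y => cst 1 y + -1 * f y ^+ n).
  by apply/funext => y /=; ring.
by apply: trigD; [exact: trig_cst|apply: trigZ; exact: trigX].
Qed.

Definition lower_box (s : 'cV[R]_k) : set 'cV[R]_k := [set y | forall j, y j 0 < s j 0].

Lemma measurable_lower_box (s : 'cV[R]_k) : measurable (lower_box s).
Proof.
have -> : lower_box s = \bigcap_(j in [set: 'I_k]) [set y | y j 0 < s j 0].
  by apply/seteqP; split=> [y h j _|y h j]; exact: h.
apply: fin_bigcap_measurable => // j _; rewrite -[X in measurable X]setTI.
by apply: measurable_fun_ltr => //; exact: measurable_coord.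
Qed.

Section Agreement.
Variables m1 m2 : {measure set 'cV[R]_k -> \bar R}.
Hypothesis agE : forall u, agree m1 m2 (fun y => expR (dot u y)).

Lemma agree_trig f : trig_poly f -> agree m1 m2 f.
Proof.
elim=> [u c|c g _ ag|g h _ ag _ ah]; [|exact: agreeZ|exact: agreeD].
apply: agree_cos_phase => t.
by have := agE (t *: u); under eq_fun do rewrite dotZl.
Qed.

(** The indicator of a lower box is reached by two bounded limits.  For a
fixed scale L, step polynomials in 1/2 + sin((y_j - s_j) / L) / 2 are
trigonometric polynomials and converge to the indicator of
sin((y_j - s_j) / L) < 0; then L tends to infinity. *)
Lemma agree_lower_box s : m1 (lower_box s) = m2 (lower_box s).
Proof.
pose G L j (y : 'cV[R]_k) : R := 2^-1 + 2^-1 * sin (L.+1%:R^-1 * (y j 0 - s j 0)).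
have G01 L j y : 0 <= G L j y <= 1.
  have := sin_le1 (L.+1%:R^-1 * (y j 0 - s j 0)).
  by have := sin_geN1 (L.+1%:R^-1 * (y j 0 - s j 0)); rewrite /G; lra.
have Gtrig L j : trig_poly (G L j).
  have -> : G L j = fun y => cst 2^-1 y +
      2^-1 * cos (dot (L.+1%:R^-1 *: delta_mx j 0) y + (- (L.+1%:R^-1 * s j 0) - pi / 2)).
    by apply/funext => y; rewrite /G dotZl dot_delta addrA cosBpihalf mulrBr.
  by apply: trigD; [exact: trig_cst|apply: trigZ; exact: trig_cos].
have ag1 : agree m1 m2 (cst 1) by apply: agree_trig; exact: trig_cst.
have prod01 (a : 'I_k -> R) : (forall j, 0 <= a j <= 1) -> `|\prod_j a j| <= 1.
  move=> a01; rewrite ger0_norm; first exact: prodr_ile1.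
  by apply: prodr_ge0 => j _; case/andP : (a01 j).
have agL L : agree m1 m2 (fun y => \prod_j (sin (L.+1%:R^-1 * (y j 0 - s j 0)) < 0)%R%:R).
  apply: (@agree_lim _ _ _ _ _ (fun n y => \prod_j step_poly n (G L j y)) _ (cst 1)) => //.
  - by move=> n; apply: agree_trig; apply: trig_prod => j; exact: trig_step.
  - by move=> n y; apply: prod01 => j; exact: step_poly01.
  - move=> y; apply: cvg_prod_seq => j; have := step_poly_cvg (G01 L j y).
    have -> // : (G L j y < 2^-1) = (sin (L.+1%:R^-1 * (y j 0 - s j 0)) < 0).
    by rewrite /G; apply/idP/idP; lra.
have [i1 i2 eI] : agree m1 m2 (fun y => \prod_j ((y j 0 - s j 0 < 0)%R%:R : R)).
  apply: (@agree_lim _ _ _ _ _ _ _ (cst 1) agL) => //.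
  - by move=> n y; apply: prod01 => j; case: ltP; rewrite ?lexx ?ler01.
  - by move=> y; apply: cvg_prod_seq => j; exact: cvg_sin_scale.
have ind : (fun y : 'cV[R]_k => \prod_j ((y j 0 - s j 0 < 0)%R%:R : R)) = \1_(lower_box s).
  apply/funext => y; rewrite indicE; have [/set_mem ys|yNs] := boolP (y \in lower_box s).
    by rewrite big1// => j _; rewrite subr_lt0 ys.
  have [j yj] : exists j, ~~ (y j 0 < s j 0).
    apply/existsP; rewrite -negb_forall; apply: contra yNs => /forallP h.
    by rewrite inE => j; exact: h.
  by rewrite (bigD1 j)//= subr_lt0 (negbTE yj) mul0r.
rewrite ind in i1 i2 eI.
have mB := measurable_lower_box s.
have f1 := integrable_fin_num measurableT i1; have f2 := integrable_fin_num measurableT i2.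
have := congr1 EFin eI; rewrite /Rintegral !fineK//.
by rewrite !integral_indic// !setIT.
Qed.

End Agreement.
End TrigPoly.

(** Lower boxes are stable under intersection and generate the Borel sets, so
agreement on them suffices. *)
Lemma mgf_unique k (m1 m2 : {measure set 'cV[R]_k -> \bar R}) :
  (forall u, agree m1 m2 (fun y => expR (dot u y))) ->
  forall A, measurable A -> m1 A = m2 A.
Proof.
move=> agE A mA.
pose G := range (@lower_box k).
pose g (n : nat) := lower_box (const_mx n%:R : 'cV[R]_k).
have cover (y : 'cV[R]_k) : exists n : nat, g n y.
  pose M := \sum_j `|y j 0|.
  exists (Num.truncn M).+1 => j; rewrite mxE.
  apply: le_lt_trans (truncnS_gt _); apply: le_trans (ler_norm _) _.
  by rewrite /M (bigD1 j)//= lerDl sumr_ge0.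
apply: (g_sigma_algebra_measure_unique G _ g) => //.
- by move=> _ [s _ <-]; exact: measurable_lower_box.
- by move=> n; exists (const_mx n%:R).
- by rewrite -subTset => y _; have [n gn] := cover y; exists n.
- move=> _ _ [s _ <-] [t _ <-]; exists (\col_j Num.min (s j 0) (t j 0)) => //.
  apply/seteqP; split=> [y h|y [h1 h2] j]; last by rewrite mxE lt_min h1 h2.
  by split=> j; have := h j; rewrite mxE lt_min => /andP[].
- by move=> _ [s _ <-]; exact: agree_lower_box.
- move=> n; have [i1 _ _] := agE 0.
  have /le_lt_trans : (m1 (g n) <= m1 setT)%E.
    by apply: le_measure; rewrite ?inE//; exact: measurable_lower_box.
  apply; move/integrableP : i1 => [_].
  under eq_integral do rewrite /= dot0l expR0 normr1.
  by rewrite integral_cst// mul1e.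
- have mid : measurable_fun setT (id : g_sigma_algebraType G -> 'cV[R]_k).
    apply: measurable_fun_mx => i c0; rewrite ord1 {c0}.
    apply: (measurability _ (RGenInftyO.measurableE R)) => _ [_ [x ->] <-].
    rewrite setTI.
    have -> : (fun y : 'cV[R]_k => y i 0) @^-1` `]-oo, x[%classic =
        \bigcup_n lower_box (\col_j if j == i then x else n%:R).
      apply/seteqP; split=> [y|y [n _ h]]; last first.
        by have := h i; rewrite mxE eqxx /= in_itv.
      rewrite /= in_itv/= => yi; have [n gn] := cover y; exists n => // j.
      by rewrite mxE; case: eqP => [->//|_]; have := gn j; rewrite mxE.
    apply: bigcupT_measurable => n; apply: sub_sigma_algebra.
    by exists (\col_j if j == i then x else n%:R).
  by have := mid measurableT A mA; rewrite setTI.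
Qed.

End MgfUniqueness.

(** * Densities and moment generating functions of normal laws *)
Section ImageMeasure.
Context {R : realType} d1 d2 {X : measurableType d1} {Y : measurableType d2}.
Variables (mu : {measure set X -> \bar R}) (phi : X -> Y).
Hypothesis mphi : measurable_fun setT phi.

Definition image_measure : {measure set Y -> \bar R} :=
  ltac:(unshelve refine (pushforward mu phi : {measure set Y -> \bar R}); exact mphi).

Lemma image_measureE A : image_measure A = mu (phi @^-1` A).
Proof. by []. Qed.

Lemma ge0_integral_image (f : Y -> \bar R) :
  measurable_fun setT f -> (forall y, 0 <= f y)%E ->
  (\int[image_measure]_y f y = \int[mu]_x f (phi x))%E.
Proof. by move=> mf f0; rewrite ge0_integral_pushforward. Qed.

End ImageMeasure.

Section Density.
Context {R : realType} d {T : measurableType d}.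
Variables (mu : {sigma_finite_measure set T -> \bar R}) (w : T -> R).
Hypothesis w0 : forall x, 0 <= w x.
Hypothesis iw : mu.-integrable setT (EFin \o w).

Let dens (A : set T) : \bar R := (\int[mu]_(x in A) (w x)%:E)%E.

Let dens0 : dens set0 = 0%E.
Proof. by rewrite /dens integral_set0. Qed.

Let dens_ge0 A : (0 <= dens A)%E.
Proof. by apply: integral_ge0 => x _; rewrite lee_fin. Qed.

Let dens_sigma_additive : semi_sigma_additive dens.
Proof.
move=> F mF tF mUF; rewrite /dens integral_bigcup//=; last first.
  exact: (integrableS _ _ (subsetT _)) iw.
apply: is_cvg_ereal_nneg_natsum_cond => n _ _.
by apply: integral_ge0 => x _; rewrite lee_fin.
Qed.

Let dens_measure : {measure set T -> \bar R} :=
  HB.pack dens (isMeasure.Build _ _ _ dens dens0 dens_ge0 dens_sigma_additive).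

Let dens_fin : fin_num_fun dens_measure.
Proof.
move=> A mA; apply: (integrable_fin_num mA (f := EFin \o w)).
exact: (integrableS _ _ (subsetT _)) iw.
Qed.

Definition density : {finite_measure set T -> \bar R} :=
  HB.pack (dens_measure : set T -> \bar R) (Measure.on dens_measure)
    (Measure_isFinite.Build _ _ _ dens_measure dens_fin).

Lemma densityE A : density A = (\int[mu]_(x in A) (w x)%:E)%E.
Proof. by []. Qed.

Let density_dominates : density `<< mu.
Proof.
apply/null_content_dominatesP => A mA muA0; rewrite densityE.
apply: null_set_integral => //; apply: measurable_funTS.
exact: measurable_int iw.
Qed.

(** By uniqueness w is a version of the Radon-Nikodym derivative of the measure
with density w, so the change of variables for that derivative applies. *)
Lemma ge0_integral_density (f : T -> \bar R) :
  measurable_fun setT f -> (forall x, 0 <= f x)%E ->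
  (\int[density]_x f x = \int[mu]_x (f x * (w x)%:E))%E.
Proof.
move=> mf f0; have mw := measurable_int _ iw.
have ig := Radon_Nikodym_SigmaFinite.f_integrable density_dominates.
rewrite -(Radon_Nikodym_SigmaFinite.change_of_variables density_dominates f0 measurableT mf).
have ae : ae_eq mu setT (EFin \o w) (Radon_Nikodym_SigmaFinite.f density mu).
  apply: integral_ae_eq => //; first exact: measurable_int ig.
  move=> E _ mE; rewrite -Radon_Nikodym_SigmaFinite.f_integral//.
apply: ge0_ae_eq_integral => //.
- by apply: emeasurable_funM => //; exact: measurable_int ig.
- exact: emeasurable_funM.
- by move=> x _; rewrite mule_ge0 ?Radon_Nikodym_SigmaFinite.f_ge0.
- by move=> x _; rewrite mule_ge0 ?lee_fin.
- by apply: ae_eqe_mul2l; exact: ae_eq_sym.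
Qed.

End Density.

Section Mgf.
Context {R : realType}.
Local Notation Rm := (measurableTypeR R).

Lemma measurable_expRM (t : R) : measurable_fun setT (fun x : Rm => (expR (t * x))%:E).
Proof.
apply/measurable_EFinP; apply: (measurableT_comp (f := @expR R)) => //.
Qed.

Lemma dotZr k c (u y : 'cV[R]_k) : dot u (c *: y) = c * dot u y.
Proof. by rewrite dotC dotZl dotC. Qed.

Definition mgf k (m : {measure set 'cV[R]_k -> \bar R}) (u : 'cV[R]_k) : \bar R :=
  (\int[m]_y (expR (dot u y))%:E)%E.

Lemma measurable_expR_dot k (u : 'cV[R]_k) :
  measurable_fun setT (fun y : 'cV[R]_k => (expR (dot u y))%:E).
Proof. by apply/measurable_EFinP; apply: measurableT_comp => //; exact: measurable_dot. Qed.

Lemma expR_dot_ge0 k (u y : 'cV[R]_k) : (0 <= (expR (dot u y))%:E)%E.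
Proof. by rewrite lee_fin expR_ge0. Qed.

(** The common values are real numbers, which gives the integrability needed
for uniqueness. *)
Lemma eq_measure_mgf k (m1 m2 : {measure set 'cV[R]_k -> \bar R}) (c : 'cV[R]_k -> R) :
  (forall u, mgf m1 u = (c u)%:E) -> (forall u, mgf m2 u = (c u)%:E) ->
  forall A, measurable A -> m1 A = m2 A.
Proof.
move=> e1 e2; apply: mgf_unique => u.
have fin (m : {measure set 'cV[R]_k -> \bar R}) : mgf m u = (c u)%:E ->
    m.-integrable setT (EFin \o (fun y => expR (dot u y))).
  move=> e; apply/integrableP; split; first exact: measurable_expR_dot.
  under eq_integral do rewrite /= ger0_norm ?expR_ge0//.
  by rewrite -/(mgf m u) e ltry.
split; [exact: fin|exact: fin|].
by rewrite /Rintegral -/(mgf m1 u) -/(mgf m2 u) e1 e2.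
Qed.

Lemma eq_measure_mgf_line (m1 m2 : {measure set Rm -> \bar R}) (c : R -> R) :
  (forall t, \int[m1]_x (expR (t * x))%:E = (c t)%:E)%E ->
  (forall t, \int[m2]_x (expR (t * x))%:E = (c t)%:E)%E ->
  forall A, measurable A -> m1 A = m2 A.
Proof.
move=> e1 e2 A mA.
have mc : measurable_fun setT (fun x : Rm => const_mx x : 'cV[R]_1).
  apply: measurable_fun_mx => i j.
  have -> : (fun x : Rm => (const_mx x : 'cV[R]_1) i j) = id by apply/funext => x; rewrite mxE.
  by move=> _ Y mY; rewrite setTI.
have mB : measurable [set y : 'cV[R]_1 | A (y 0 0)].
  have := @measurable_coord R 1 1 0 0 measurableT _ mA.
  by rewrite setTI.
have := @eq_measure_mgf 1 (image_measure m1 mc) (image_measure m2 mc) (fun u => c (u 0 0)).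
have h (m : {measure set Rm -> \bar R}) u : mgf (image_measure m mc) u =
    (\int[m]_x (expR (u 0%R 0%R * x))%:E)%E.
  rewrite /mgf (ge0_integral_image m mc (measurable_expR_dot u) (expR_dot_ge0 u)).
  by apply: eq_integral => x _; rewrite dotE big_ord_recl big_ord0 addr0 mxE.
move=> /(_ (fun u => etrans (h m1 u) (e1 _)) (fun u => etrans (h m2 u) (e2 _)) _ mB) e.
have <- : (fun x : Rm => const_mx x : 'cV[R]_1) @^-1` [set y | A (y 0 0)] = A.
  by apply/seteqP; split=> x /=; rewrite mxE.
exact: e.
Qed.

(** Completing the square: exponential tilting shifts a normal density. *)
Lemma normal_pdf_tilt (m s t x : R) : s != 0 ->
  expR (t * x) * normal_pdf m s x =
  expR (t * m + t ^+ 2 * s ^+ 2 / 2) * normal_pdf (m + t * s ^+ 2) s x.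
Proof.
move=> s0; rewrite !normal_pdfE// mulrCA [RHS]mulrCA /normal_fun -!expRD.
congr (_ * expR _); rewrite -mulr_natl; set i := (2 * s ^+ 2)^-1.
have s20 : 2 * s ^+ 2 != 0 by rewrite mulf_neq0 ?pnatr_eq0 ?expf_neq0.
have ai : s ^+ 2 * i = 2^-1 by apply: (mulfI (x := 2)); rewrite ?pnatr_eq0// mulrA /i !divff.
move: ai; move: (s ^+ 2) i => a i ai.
have -> : - (x - (m + t * a)) ^+ 2 * i =
  - (x - m) ^+ 2 * i + 2 * t * (x - m) * (a * i) - t ^+ 2 * a * (a * i) by ring.
by rewrite ai; lra.
Qed.

Lemma normal_prob_mgf (m s t : R) : s != 0 ->
  (\int[normal_prob m s]_x (expR (t * x))%:E =
   (expR (t * m + t ^+ 2 * s ^+ 2 / 2))%:E)%E.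
Proof.
move=> s0.
have me := measurable_expRM t.
have ipdf : (@lebesgue_measure R).-integrable setT (EFin \o normal_pdf m s).
  exact: (integrable_normal_pdf m s).
rewrite (eq_measure_integral (@density R _ Rm lebesgue_measure (normal_pdf m s) (normal_pdf_ge0 m s) ipdf))//.
rewrite ge0_integral_density//.
under eq_integral do rewrite -EFinM normal_pdf_tilt// EFinM.
rewrite ge0_integralZl//=.
- by rewrite integral_normal_pdf mule1.
- by apply/measurable_EFinP; exact: measurable_normal_pdf.
- by move=> x _; rewrite lee_fin normal_pdf_ge0.
Qed.

Lemma normal1_mgf (nu : {measure set Rm -> \bar R}) (m v : R) : 0 <= v ->
  (forall A, measurable A -> nu A = normal1 m v A) ->
  forall t, (\int[nu]_x (expR (t * x))%:E = (expR (t * m + t ^+ 2 * v / 2))%:E)%E.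
Proof.
move=> v0 nuE t; have [v_eq0|vN0] := eqVneq v 0.
  rewrite (eq_measure_integral (\d_(m : Rm))); last first.
    by move=> A mA _; rewrite nuE// /normal1 v_eq0 eqxx.
  rewrite integral_dirac//; last exact: measurable_expRM.
  by rewrite diracT mul1e v_eq0 mulr0 mul0r addr0.
have s0 : Num.sqrt v != 0 by rewrite sqrtr_eq0 -ltNge lt_neqAle eq_sym vN0.
rewrite (eq_measure_integral (normal_prob m (Num.sqrt v))); last first.
  by move=> A mA _; rewrite nuE// /normal1 (negbTE vN0).
by rewrite normal_prob_mgf// sqr_sqrtr.
Qed.

Lemma mgf_normal1 (nu : {measure set Rm -> \bar R}) (m v : R) : 0 <= v ->
  (forall t, (\int[nu]_x (expR (t * x))%:E = (expR (t * m + t ^+ 2 * v / 2))%:E)%E) ->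
  forall A, measurable A -> nu A = normal1 m v A.
Proof.
move=> v0 nuE A mA; rewrite /normal1; case: ifPn => [/eqP v_eq0|vN0].
  apply: (eq_measure_mgf_line (m2 := \d_(m : Rm)) nuE) => // t.
  by apply: (@normal1_mgf _ m v) => // B mB; rewrite /normal1 v_eq0 eqxx.
apply: (eq_measure_mgf_line (m2 := normal_prob m (Num.sqrt v)) nuE) => // t.
by apply: (@normal1_mgf _ m v) => // B mB; rewrite /normal1 (negbTE vN0).
Qed.

Lemma mvnormal_mgf k (N : {measure set 'cV[R]_k -> \bar R}) m V :
  mvnormal N m V -> forall u, mgf N u = (expR (dot u m + dot u (V *m u) / 2))%:E.
Proof.
move=> [_ NV] u; have [v0 uN] := NV u.
have md : measurable_fun setT (dot u : _ -> Rm) by exact: measurable_dot.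
have := @normal1_mgf (image_measure N md) _ _ v0 (fun A mA => uN A mA) 1.
rewrite ge0_integral_image; first last.
- by move=> y; rewrite lee_fin expR_ge0.
- exact: measurable_expRM.
under eq_integral do rewrite mul1r.
by rewrite /mgf => ->; rewrite mul1r expr1n mul1r {1 2}/dot mulmxA.
Qed.

(** Along the line spanned by u, the function t |-> mgf(t u) is the moment
generating function of the linear form u'y; uniqueness on the line identifies
its law. *)
Lemma mgf_mvnormal k (N : {measure set 'cV[R]_k -> \bar R}) m (V : 'M[R]_k) :
  V^T = V -> (forall u, 0 <= dot u (V *m u)) ->
  (forall u, mgf N u = (expR (dot u m + dot u (V *m u) / 2))%:E) ->
  mvnormal N m V.
Proof.
move=> symV psdV NE; split=> // u; rewrite -mulmxA; split; first exact: psdV.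
move=> A mA; have md : measurable_fun setT (dot u : _ -> Rm) by exact: measurable_dot.
apply: (mgf_normal1 (nu := image_measure N md)) => [|t|//]; first exact: psdV.
rewrite ge0_integral_image; first last.
- by move=> y; rewrite lee_fin expR_ge0.
- exact: measurable_expRM.
under eq_integral do rewrite -dotZl.
rewrite -/(mgf N (t *: u)) NE; congr (expR _)%:E.
by rewrite -scalemxAr !dotZl dotZr /dot; ring.
Qed.

End Mgf.

(** * A mapping theorem for lower limits of expectations *)
Section BoundedExpectation.
Context {R : realType} d {T : measurableType d} (P : probability T R).

Lemma bounded_integrable (f : T -> R) (B : R) :
  measurable_fun setT f -> (forall x, `|f x| <= B) -> P.-integrable setT (EFin \o f).
Proof.
move=> mf fB; apply: measurable_bounded_integrable => //.
  by rewrite -ge0_fin_numE// fin_num_measure.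
exists B; split; first exact: num_real.
by move=> b Bb x _; exact: le_trans (fB x) (ltW Bb).
Qed.

Lemma Rintegral_cst_prob (c : R) : \int[P]_x c = c.
Proof. rewrite /Rintegral integral_cst//.
transitivity (fine (c%:E * 1)%E); last by rewrite mule1.
by congr (fine (_ * _)%E); exact: (probability_setT P). Qed.

Lemma le_Rintegral_except (f g : T -> R) (B c K : R) (A : set T) :
  measurable_fun setT f -> measurable_fun setT g -> measurable A ->
  (forall x, `|f x| <= B) -> (forall x, `|g x| <= B) ->
  (forall x, g x - c - K * \1_A x <= f x) ->
  \int[P]_x g x - c - K * fine (P A) <= \int[P]_x f x.
Proof.
move=> mf mg mA fB gB h.
have if_ := bounded_integrable mf fB; have ig := bounded_integrable mg gB.
have ic : P.-integrable setT (EFin \o cst c) by exact: finite_measure_integrable_cst.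
have iA : P.-integrable setT (EFin \o (\1_A : T -> R)) by exact: integrable_indic.
have iKA : P.-integrable setT (EFin \o (fun x => K * \1_A x)).
  by have := integrableZl measurableT K iA; apply: eq_integrable => // x _; rewrite /= EFinM.
have igc : P.-integrable setT (EFin \o (fun x => g x - c)).
  by have := integrableB measurableT ig ic; apply: eq_integrable => // x _; rewrite /= EFinB.
have -> : fine (P A) = \int[P]_x \1_A x by rewrite /Rintegral integral_indic// setIT.
rewrite -RintegralZl// -[X in _ - X - _]Rintegral_cst_prob -RintegralB// -RintegralB//.
apply: le_Rintegral => //.
by have := integrableB measurableT igc iKA; apply: eq_integrable => // x _; rewrite /= EFinB.
Qed.

End BoundedExpectation.

Section LowerEnvelope.
Context {R : realType} {k : nat} {W : normedModType R}.
Variables (F : 'cV[R]_k -> W -> R) (B : R).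
Hypothesis FB : forall z v, `|F z v| <= B.

(** Inf-convolution of F with a Lipschitz penalty.  It depends on z alone, is
m-Lipschitz, bounds F z v from below up to m |v|, and increases to F z 0 at the
points where F is continuous at (z, 0). *)
Definition lower_env (m : R) (z : 'cV[R]_k) : R :=
  inf (range (fun t : 'cV[R]_k * W => F t.1 t.2 + m * (`|z - t.1| + `|t.2|))).

Section Fixed.
Variable m : R.
Hypothesis m0 : 0 <= m.

Let pen_ge0 (z z' : 'cV[R]_k) (v : W) : 0 <= m * (`|z - z'| + `|v|).
Proof. by rewrite mulr_ge0// addr_ge0. Qed.

Let Fge z v : - B <= F z v.
Proof. by have := FB z v; rewrite ler_norml => /andP[]. Qed.

Lemma lower_env_le z z' v : lower_env m z <= F z' v + m * (`|z - z'| + `|v|).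
Proof.
apply: ge_inf; last by exists (z', v).
exists (- B) => _ [t _ <-]; have := pen_ge0 z t.1 t.2; have := Fge t.1 t.2; lra.
Qed.

Lemma lower_env_ge z c :
  (forall z' v, c <= F z' v + m * (`|z - z'| + `|v|)) -> c <= lower_env m z.
Proof.
move=> h; apply: lb_le_inf; first by eexists; exists (0, 0).
by move=> _ [t _ <-]; exact: h.
Qed.

Lemma lower_env_bound z : `|lower_env m z| <= B.
Proof.
rewrite ler_norml; apply/andP; split.
  by apply: lower_env_ge => z' v; have := pen_ge0 z z' v; have := Fge z' v; lra.
have := lower_env_le z z 0; rewrite subrr !normr0 addr0 mulr0 addr0 => /le_trans; apply.
exact: le_trans (ler_norm _) (FB _ _).
Qed.

Lemma lower_env_lip z y : lower_env m z <= lower_env m y + m * `|z - y|.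
Proof.
rewrite -lerBlDr; apply: lower_env_ge => z' v.
have := lower_env_le z z' v; have := ler_distD y z z' => h1 h2.
have : m * `|z - z'| <= m * (`|z - y| + `|y - z'|) by rewrite ler_wpM2l.
lra.
Qed.

Lemma lower_env_continuous : continuous (lower_env m).
Proof.
move=> z A /nbhs_ballP[e /= e0 eA]; apply/nbhs_ballP.
have m10 : 0 < m + 1 by rewrite ltr_wpDl.
exists (e / (m + 1)) => /=; first by rewrite divr_gt0.
move=> y; rewrite -ball_normE /= ltr_pdivlMr// => zy; apply: eA.
rewrite /ball /=; apply: (@le_lt_trans _ _ (m * `|z - y|)).
  rewrite ler_norml; have := lower_env_lip z y; have := lower_env_lip y z.
  by rewrite (distrC y); lra.
by apply: le_lt_trans zy; rewrite mulrC ler_wpM2l// lerDl.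
Qed.

End Fixed.

Definition cont_at0 z := forall e, 0 < e -> exists2 d, 0 < d &
  forall z' v, `|z' - z| < d -> `|v| < d -> `|F z' v - F z 0| < e.

Lemma lower_env_cvg z : cont_at0 z -> lower_env n%:R z @[n --> \oo] --> F z 0.
Proof.
move=> cz; apply/cvgrPdist_le => e e0; have [d d0 h] := cz _ e0.
have B0 : 0 <= B := le_trans (normr_ge0 _) (FB 0 0).
near=> n; have n0 : 0 <= n%:R :> R by [].
have := lower_env_le n0 z z 0; rewrite subrr !normr0 addr0 mulr0 addr0 => up.
have lo : F z 0 - e <= lower_env n%:R z.
  apply: lower_env_ge => // z' v.
  have : 0 <= n%:R * (`|z - z'| + `|v|) by rewrite mulr_ge0// addr_ge0.
  have [/andP[zd vd]|] := boolP ((`|z' - z| < d) && (`|v| < d)).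
    by have := h _ _ zd vd; rewrite ltr_norml; lra.
  rewrite negb_and -!leNgt => far _.
  have : d <= `|z - z'| + `|v|.
    by rewrite distrC; case/orP: far; have := normr_ge0 v; have := normr_ge0 (z' - z); lra.
  move=> /(ler_wpM2l n0) dn.
  have nd : 2 * B <= n%:R * d.
    rewrite -ler_pdivrMr//; near: n; exact: nbhs_infty_ger.
  have := FB z 0; have := FB z' v; rewrite !ler_norml; lra.
by rewrite ler_norml; lra.
Unshelve. all: by end_near.
Qed.

End LowerEnvelope.

Section LiminfMapping.
Context {R : realType} {d : nat -> measure_display} {X : forall n, measurableType (d n)}.

Lemma lower_env_Rintegral_cvg k (N : probability 'cV[R]_k R) (W : normedModType R)
    (F : 'cV[R]_k -> W -> R) (B : R) :
  (forall z v, `|F z v| <= B) -> measurable_fun setT (F^~ 0) ->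
  {ae N, forall z, cont_at0 F z} ->
  \int[N]_z lower_env F n%:R z @[n --> \oo] --> \int[N]_z F z 0.
Proof.
move=> FB mF0 cF; have B0 : 0 <= B := le_trans (normr_ge0 _) (FB 0 0).
have iB : N.-integrable setT (EFin \o cst B) by exact: finite_measure_integrable_cst.
have [||||//|_ _ fl] := @dominated_convergence _ _ R N setT measurableT
  (fun n => EFin \o lower_env F n%:R) (EFin \o F^~ 0) (EFin \o cst B).
- move=> n; apply/measurable_EFinP; apply: continuous_measurable_mx.
  exact: (lower_env_continuous FB).
- exact/measurable_EFinP.
- apply: filterS cF => z cz _; apply: cvg_EFin; first exact: nearW.
  exact: (lower_env_cvg FB).
- exact: iB.
- by apply: aeW => z n _; rewrite /= lee_fin; exact: lower_env_bound.
rewrite /Rintegral; apply: fine_cvg; rewrite fineK//.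
apply: (integrable_fin_num measurableT (f := EFin \o F^~ 0)).
by apply: (bounded_integrable N (B := B) mF0) => z; exact: FB.
Qed.

(** Weak convergence applies to the continuous lower envelope, which is below
F (Y n) (V n) up to a small error outside the event where V n is large, and
whose integral is close to that of F z 0 by dominated convergence.  A bound in
one direction is all that the likelihood ratio argument needs. *)
Lemma liminf_mapping (P : forall n, probability (X n) R) k
    (Y : forall n, X n -> 'cV[R]_k) (N : probability 'cV[R]_k R)
    (W : normedModType R) (V : forall n, X n -> W)
    (F : 'cV[R]_k -> W -> R) (B e : R) :
  (forall n, measurable_fun setT (Y n)) -> weak_cvg P Y N id ->
  (forall n, measurable_fun setT (fun x => `|V n x|)) ->
  (forall a, 0 < a -> P n [set x | a < `|V n x|] @[n --> \oo] --> 0%E) ->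
  (forall z v, `|F z v| <= B) ->
  (forall n, measurable_fun setT (fun x => F (Y n x) (V n x))) ->
  measurable_fun setT (F^~ 0) ->
  {ae N, forall z, cont_at0 F z} -> 0 < e ->
  \forall n \near \oo, \int[N]_z F z 0 - e <= \int[P n]_x F (Y n x) (V n x).
Proof.
move=> mY YN mV V0 FB mF mF0 cF e0.
have B0 : 0 <= B := le_trans (normr_ge0 _) (FB 0 0).
have e40 : 0 < e / 4 by rewrite divr_gt0.
have [m Hm] : exists m : nat, \int[N]_z F z 0 - e / 4 <= \int[N]_z lower_env F m.+1%:R z.
  have /cvgrPdist_le/(_ _ e40)[m _ /(_ m.+1 (leqnSn m)) /=] :=
    lower_env_Rintegral_cvg FB mF0 cF.
  by rewrite ler_norml => h; exists m; move: h; lra.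
pose M : R := m.+1%:R; have M0 : 0 < M by rewrite ltr0n.
have cenv := lower_env_continuous FB (ltW M0).
have mcenv := continuous_measurable_mx cenv.
have env_cvg : \int[P n]_x lower_env F M (Y n x) @[n --> \oo] --> \int[N]_z lower_env F M z.
  have bd : bounded_fun (lower_env F M).
    exists B; split; first exact: num_real.
    by move=> b Bb z _; exact: le_trans (lower_env_bound FB (ltW M0) z) (ltW Bb).
  have := YN _ cenv bd; rewrite /Rintegral => h; apply: fine_cvg; rewrite fineK//.
  apply: (integrable_fin_num measurableT (f := EFin \o lower_env F M)).
  exact: (bounded_integrable N mcenv (lower_env_bound FB (ltW M0))).
have V0' : (2 * B) * fine (P n [set x | e / 4 / M < `|V n x|]) @[n --> \oo] --> 2 * B * 0.
  apply: cvgMr; apply: fine_cvg; apply: V0; by rewrite divr_gt0.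
rewrite mulr0 in V0'.
near=> n.
have Ph : \int[N]_z lower_env F M z - e / 4 <= \int[P n]_x lower_env F M (Y n x).
  have : `|\int[N]_z lower_env F M z - \int[P n]_x lower_env F M (Y n x)| <= e / 4.
    by near: n; move/cvgrPdist_le : env_cvg; exact.
  by rewrite ler_norml; lra.
have PV : 2 * B * fine (P n [set x | e / 4 / M < `|V n x|]) <= e / 4.
  have : `|0 - 2 * B * fine (P n [set x | e / 4 / M < `|V n x|])| <= e / 4.
    by near: n; move/cvgrPdist_le : V0'; exact.
  by rewrite ler_norml; lra.
have := @le_Rintegral_except R _ _ (P n) (fun x => F (Y n x) (V n x))
  (fun x => lower_env F M (Y n x)) B (e / 4) (2 * B) [set x | e / 4 / M < `|V n x|].
have mA : measurable [set x | e / 4 / M < `|V n x|].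
  by rewrite -[X in measurable X]setTI; exact: measurable_fun_ltr.
have menv : measurable_fun setT (fun x => lower_env F M (Y n x)).
  by apply: (measurableT_comp mcenv).
move=> /(_ (mF n) menv mA (fun x => FB _ _) (fun x => lower_env_bound FB (ltW M0) _)) h.
have : \int[P n]_x lower_env F M (Y n x) - e / 4 -
    2 * B * fine (P n [set x | e / 4 / M < `|V n x|]) <= \int[P n]_x F (Y n x) (V n x).
  apply: h => x; rewrite indicE.
  have [/set_mem /= Vbig|/negP Vs] := boolP (x \in [set x | e / 4 / M < `|V n x|]).
    have := FB (Y n x) (V n x); have := lower_env_bound FB (ltW M0) (Y n x).
    by rewrite !ler_norml => /andP[_ h1] /andP[h2 _]; lra.
  have {}Vs : `|V n x| <= e / 4 / M.
    by rewrite leNgt; apply/negP => Vb; apply: Vs; rewrite inE.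
  have := lower_env_le FB (ltW M0) (Y n x) (Y n x) (V n x).
  rewrite subrr normr0 add0r mulr0 subr0; move: Vs; rewrite ler_pdivlMr//; lra.
move: Hm; rewrite -/M; lra.
Unshelve. all: by end_near.
Qed.

End LiminfMapping.

(** * Le Cam's third lemma as a lower bound *)
Section LikelihoodRatio.
Context {R : realType}.

(** The difference is finite only where both densities are nonzero with the
same sign.  The absolute values allow densities that are nonnegative only
almost everywhere. *)
Lemma lne_ratio_near (b a c e : R) : 0 <= e ->
  (`|lne (b%:E / a%:E) - c%:E| <= e%:E)%E =
  (0 < b * a) && (`|ln `|b| - ln `|a| - c| <= e).
Proof.
move=> e0; have [->|a0] := eqVneq a 0.
  rewrite mulr0 ltxx /= inver eqxx.
  have [b0|b0|->] := ltgtP b 0; last by rewrite mul0e /= lexx.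
    by rewrite lt0_muley ?lte_fin.
  by rewrite gt0_muley ?lte_fin.
rewrite inver (negbTE a0) -EFinM /=.
have -> : (b / a <= 0) = ~~ (0 < b * a).
  rewrite -leNgt; have a20 : 0 < a ^+ 2 by rewrite exprn_even_gt0.
  rewrite -(ler_pM2r a20) mul0r; congr (_ <= _).
  by rewrite expr2 mulrA divfK.
case: ifPn => [/negbTE ->|] //; rewrite negbK => ba; rewrite ba /= lee_fin.
congr (`|_ - _| <= _).
have b0 : b != 0 by apply: contraTneq ba => ->; rewrite mul0r ltxx.
have ba' : b / a = `|b| / `|a|.
  rewrite -normf_div ger0_norm// ltW//.
  have a20 : 0 < a ^+ 2 by rewrite exprn_even_gt0.
  by rewrite -(ltr_pM2r a20) mul0r expr2 mulrA divfK.
by rewrite ba' ln_div ?posrE ?normr_gt0.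
Qed.

Lemma expR_ln_ratio (q p c e : R) : 0 < q -> 0 < p ->
  `|ln q - ln p - c| <= e -> expR (c - e) * p <= q.
Proof.
move=> q0 p0; rewrite ler_norml => /andP[lo _].
by rewrite -[X in _ * X]lnK ?posrE// -[leRHS]lnK ?posrE// -expRD ler_expR; lra.
Qed.

Section TwoLaws.
Context d {X : measurableType d} (P Q : probability X R).
Local Notation mu := (measure_add P Q).

Let PQ_dominates (A : set X) : measurable A -> mu A = 0%E -> P A = 0%E /\ Q A = 0%E.
Proof.
move=> mA; rewrite measure_addE => /eqP; rewrite padde_eq0// => /andP[/eqP pA /eqP qA].
by split.
Qed.

Let P_mu : P `<< mu.
Proof. by apply/null_content_dominatesP => A mA /(PQ_dominates mA)[]. Qed.

Let Q_mu : Q `<< mu.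
Proof. by apply/null_content_dominatesP => A mA /(PQ_dominates mA)[]. Qed.

Local Notation dP := (Radon_Nikodym (charge_of_finite_measure P) mu).
Local Notation dQ := (Radon_Nikodym (charge_of_finite_measure Q) mu).

Let dPE x : dP x = (fine (dP x))%:E.
Proof. by rewrite fineK// Radon_Nikodym_fin_num. Qed.

Let dQE x : dQ x = (fine (dQ x))%:E.
Proof. by rewrite fineK// Radon_Nikodym_fin_num. Qed.

Let mdP : measurable_fun setT (fun x => fine (dP x)).
Proof.
by apply: measurableT_comp => //; apply: (measurable_int mu).
Qed.

Let mdQ : measurable_fun setT (fun x => fine (dQ x)).
Proof.
by apply: measurableT_comp => //; apply: (measurable_int mu).
Qed.

Variables (quad : X -> R) (e : R).
Hypotheses (mquad : measurable_fun setT quad) (e0 : 0 <= e).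

(** Off this event, q / p lies within a factor e^e of exp(quad). *)
Definition lr_bad : set X :=
  [set x | (e%:E < `|log_likelihood_ratio Q P x - (quad x)%:E|)%E].

Let lr_goodE x : (~ lr_bad x) = ((0 < fine (dQ x) * fine (dP x)) &&
  (`|ln `|fine (dQ x)| - ln `|fine (dP x)| - quad x| <= e)) :> Prop.
Proof.
rewrite -lne_ratio_near// -dPE -dQE /lr_bad /mkset ltNge /log_likelihood_ratio.
by rewrite propeqE; split=> [/negP|h]; rewrite ?negbK//; apply/negP; rewrite negbK.
Qed.

Lemma measurable_lr_bad : measurable lr_bad.
Proof.
have -> : lr_bad = ~` ([set x | 0 < fine (dQ x) * fine (dP x)] `&`
    [set x | `|ln `|fine (dQ x)| - ln `|fine (dP x)| - quad x| <= e]).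
  rewrite -[LHS]setCK; congr (~` _); apply/seteqP; split=> x.
    by rewrite /setC /mkset lr_goodE => /andP[].
  by move=> [h1 h2]; rewrite /setC /mkset lr_goodE h1 h2.
apply: measurableC; apply: measurableI; rewrite -[X in measurable X]setTI.
  by apply: measurable_fun_ltr => //; exact: measurable_funM.
apply: measurable_fun_ler => //; apply: measurableT_comp => //.
have mln (f : X -> R) : measurable_fun setT f -> measurable_fun setT (fun x => ln `|f x|).
  by move=> mf; apply: measurableT_comp; [exact: measurable_ln|exact: measurableT_comp].
by apply: measurable_funB => //; apply: measurable_funB; exact: mln.
Qed.

(** Off [lr_bad], q >= e^(-e) exp(quad) p, hence
q >= e^(-e) min(exp(quad), M) p; the truncation at M bounds what is lost by
leaving out [lr_bad].  The part of Q that is singular to P only helps. *)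
Lemma lr_lower_bound (h : X -> R) (K M : R) :
  measurable_fun setT h -> (forall x, 0 <= h x <= K) -> 0 <= M ->
  expR (- e) * (\int[P]_x (h x * Num.min (expR (quad x)) M) - K * M * fine (P lr_bad))
  <= \int[Q]_x h x.
Proof.
move=> mh hK M0; pose w x := Num.min (expR (quad x)) M.
have w0 x : 0 <= w x by rewrite le_min expR_ge0.
have wM x : w x <= M by rewrite ge_min lexx orbT.
have mw : measurable_fun setT w.
  by apply: measurable_minr => //; exact: measurableT_comp.
have mbad := measurable_lr_bad.
have ce0 : 0 <= expR (- e) by exact: expR_ge0.
have ce1 : expR (- e) <= 1 by rewrite -expR0 ler_expR oppr_le0.
pose g x := expR (- e) * (h x * w x) * \1_(~` lr_bad) x.
have mg : measurable_fun setT g.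
  apply: measurable_funM; last by apply: measurable_indic; exact: measurableC.
  by apply: measurable_funM => //; exact: measurable_funM.
have h0 x : 0 <= h x by have /andP[] := hK x.
have g0 x : 0 <= g x by rewrite !mulr_ge0.
have hwKM x : h x * w x <= K * M.
  by rewrite ler_pM//; have /andP[] := hK x.
have K0 x : 0 <= K := le_trans (h0 x) (proj2 (andP (hK x))).
have PQ : \int[P]_x g x <= \int[Q]_x h x.
  have ig : P.-integrable setT (EFin \o g).
    apply: (bounded_integrable _ (B := K * M)) => // x; rewrite ger0_norm//.
    apply: le_trans (hwKM x); rewrite /g mulrAC -[leRHS]mul1r ler_wpM2r ?mulr_ge0//.
    by rewrite indicE mulr_ile1//; case: (_ \in _).
  have ih : Q.-integrable setT (EFin \o h).
    by apply: (bounded_integrable _ (B := K)) => // x; rewrite ger0_norm//; have /andP[] := hK x.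
  rewrite /Rintegral fine_le//; [exact: (integrable_fin_num measurableT ig)|
    exact: (integrable_fin_num measurableT ih)|].
  have meg : measurable_fun setT (EFin \o g) by exact/measurable_EFinP.
  have meh : measurable_fun setT (EFin \o h) by exact/measurable_EFinP.
  rewrite -(Radon_Nikodym_SigmaFinite.change_of_variables P_mu (f := EFin \o g))//.
  rewrite -(Radon_Nikodym_SigmaFinite.change_of_variables Q_mu (f := EFin \o h))//.
  have ifP := Radon_Nikodym_SigmaFinite.f_integrable P_mu.
  have ifQ := Radon_Nikodym_SigmaFinite.f_integrable Q_mu.
  have fP0 := Radon_Nikodym_SigmaFinite.f_ge0 P_mu.
  have fQ0 := Radon_Nikodym_SigmaFinite.f_ge0 Q_mu.
  apply: ae_ge0_le_integral => //.
  - by move=> x _; rewrite mule_ge0// lee_fin.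
  - by apply: emeasurable_funM => //; exact: measurable_int ifP.
  - by move=> x _; rewrite mule_ge0// lee_fin.
  - by apply: emeasurable_funM => //; exact: measurable_int ifQ.
  have aeP := ae_eq_Radon_Nikodym_SigmaFinite P_mu measurableT.
  have aeQ := ae_eq_Radon_Nikodym_SigmaFinite Q_mu measurableT.
  apply: filterS2 aeP aeQ => x /(_ I) eP /(_ I) eQ _.
  have := fP0 x; have := fQ0 x; rewrite eP eQ dPE dQE !lee_fin => q0 p0.
  suff : g x * fine (dP x) <= h x * fine (dQ x) by rewrite -lee_fin.
  rewrite /g indicE.
  case: (boolP (x \in ~` lr_bad)) => [/set_mem xg|_]; last first.
    by rewrite mulr0 mul0r mulr_ge0.
  rewrite mulr1; move: xg; rewrite /setC /mkset lr_goodE => /andP[].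
  set q := fine (dQ x) in q0 *; set p := fine (dP x) in p0 * => qp.
  have q1 : 0 < q by rewrite lt_neqAle q0 andbT eq_sym; apply: contraTneq qp => ->; rewrite mul0r ltxx.
  have p1 : 0 < p by rewrite lt_neqAle p0 andbT eq_sym; apply: contraTneq qp => ->; rewrite mulr0 ltxx.
  rewrite (gtr0_norm q1) (gtr0_norm p1) => /(expR_ln_ratio q1 p1) qpe.
  rewrite mulrCA -!mulrA ler_wpM2l// mulrCA mulrA.
  apply: le_trans qpe; rewrite ler_wpM2r// expRD ler_wpM2r//.
  by rewrite ge_min lexx.
apply: le_trans PQ.
have iw : P.-integrable setT (EFin \o (fun x => h x * w x)).
  apply: (bounded_integrable _ (B := K * M)); first exact: measurable_funM.
  by move=> x; rewrite ger0_norm ?mulr_ge0.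
rewrite mulrBr -RintegralZl// mulrA -[X in X - _]subr0.
apply: (@le_Rintegral_except _ _ _ _ _ _ (K * M)) => //.
- by apply: measurable_funM => //; exact: measurable_funM.
- move=> x; rewrite ger0_norm//.
  apply: le_trans (hwKM x); rewrite /g mulrAC -[leRHS]mul1r ler_wpM2r ?mulr_ge0//.
  by rewrite indicE mulr_ile1//; case: (_ \in _).
- move=> x; rewrite -/(w x) ger0_norm ?mulr_ge0//.
  by apply: le_trans (hwKM x); rewrite ler_piMl// mulr_ge0.
- move=> x; rewrite -/(w x) subr0 /g !indicE in_setC.
  case: (x \in lr_bad) => /=; rewrite ?mulr0 ?mulr1 ?subr0//.
  by rewrite subr_le0 ler_wpM2l.
Qed.

End TwoLaws.

Section LeCam.
Context {d : nat -> measure_display} {X : forall n, measurableType (d n)}.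

(** The exceptional event enters the lower bound only through its probability
under P n, which vanishes, so that contiguity never has to be established. *)
Lemma lecam_liminf (P Q : forall n, probability (X n) R)
    (quad h : forall n, X n -> R) (K M l : R) :
  oP1 P (fun n x => (log_likelihood_ratio (Q n) (P n) x - (quad n x)%:E)%E) ->
  (forall n, measurable_fun setT (quad n)) -> (forall n, measurable_fun setT (h n)) ->
  (forall n x, 0 <= h n x <= K) -> 0 <= M ->
  (forall e, 0 < e -> \forall n \near \oo,
    l - e <= \int[P n]_x (h n x * Num.min (expR (quad n x)) M)) ->
  forall e, 0 < e -> \forall n \near \oo, l - e <= \int[Q n]_x h n x.
Proof.
move=> op mquad mh hK M0 Pl e e0.
(* The loss is a factor e^(-a), at least 1 - a, and two errors of size a. *)
pose a := e / (2 + `|l|).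
have l2 : 0 < 2 + `|l| by rewrite ltr_pwDl.
have a0 : 0 < a by rewrite divr_gt0.
have ae : a * 2 + a * `|l| = e by rewrite -mulrDr divfK// gt_eqF.
have bad0 : K * M * fine (P n (lr_bad (P n) (Q n) (quad n) a)) @[n --> \oo] --> K * M * 0.
  by apply: cvgMr; apply: fine_cvg; exact: op.
rewrite mulr0 in bad0.
near=> n.
have Pn : l - a <= \int[P n]_x (h n x * Num.min (expR (quad n x)) M).
  by near: n; exact: Pl.
have Bn : K * M * fine (P n (lr_bad (P n) (Q n) (quad n) a)) <= a.
  have : `|0 - K * M * fine (P n (lr_bad (P n) (Q n) (quad n) a))| <= a.
    by near: n; move/cvgrPdist_le : bad0; exact.
  by rewrite ler_norml; lra.
have := lr_lower_bound (P n) (Q n) (mquad n) (ltW a0) (mh n) (hK n) M0.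
set I := (X in expR _ * X <= _) => hI.
have Iv : l - 2 * a <= I by rewrite /I; lra.
have J0 : 0 <= \int[Q n]_x h n x by apply: Rintegral_ge0 => x _; have /andP[] := hK n x.
have al0 : 0 <= a * `|l| by rewrite mulr_ge0// ltW.
have [v0|v0] := leP (l - 2 * a) 0; first by lra.
have ea := expR_ge1Dx (- a).
have : (1 - a) * I <= expR (- a) * I by rewrite ler_wpM2r//; lra.
have [a1|a1] := leP a 1.
  have : (1 - a) * (l - 2 * a) <= (1 - a) * I by rewrite ler_wpM2l// subr_ge0.
  have := ler_norm l; nra.
have : 1 * `|l| <= a * `|l| by rewrite ler_wpM2r// ltW.
have := ler_norm l; lra.
Unshelve. all: by end_near.
Qed.

End LeCam.
End LikelihoodRatio.

(** * Positive semidefinite matrices and linear regression *)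
Section Psd.
Context {R : realType}.

Lemma dot_self_eq0 k (w : 'cV[R]_k) : dot w w = 0 -> w = 0.
Proof.
rewrite dotE => /eqP; rewrite psumr_eq0 => [/allP w0|i _]; last by rewrite -expr2 sqr_ge0.
apply/matrixP => i j; rewrite ord1 mxE; apply/eqP; rewrite -sqrf_eq0 expr2.
by apply: w0; rewrite mem_index_enum.
Qed.

Lemma dot_self_ge0 k (w : 'cV[R]_k) : 0 <= dot w w.
Proof. by rewrite dotE sumr_ge0// => i _; rewrite -expr2 sqr_ge0. Qed.

Definition psd k (S : 'M[R]_k) : Prop :=
  S^T = S /\ forall x : 'cV[R]_k, 0 <= dot x (S *m x).

Lemma mvnormal_psd k (N : {measure set 'cV[R]_k -> \bar R}) m V : mvnormal N m V -> psd V.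
Proof. by move=> [VT NV]; split=> // x; have [] := NV x; rewrite -mulmxA. Qed.

Lemma psd_conj k l (S : 'M[R]_k) (C : 'M[R]_(l, k)) : psd S -> psd (C *m S *m C^T).
Proof.
move=> [ST S0]; split; first by rewrite !trmx_mul trmxK ST mulmxA.
by move=> x; rewrite -!mulmxA dot_mulmx; exact: S0.
Qed.

Lemma dot_symm k (S : 'M[R]_k) x y : S^T = S -> dot x (S *m y) = dot y (S *m x).
Proof. by move=> ST; rewrite dot_mulmx ST dotC. Qed.

Lemma quad_formD k (S : 'M[R]_k) x y : S^T = S ->
  dot (x + y) (S *m (x + y)) = dot x (S *m x) + 2 * dot x (S *m y) + dot y (S *m y).
Proof. by move=> ST; rewrite mulmxDr !dotDr !dotDl (dot_symm y x ST); ring. Qed.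

(** If S x were nonzero, moving from x a little in the direction - S x would
make the quadratic form negative. *)
Lemma psd_kernel k (S : 'M[R]_k) x : psd S -> dot x (S *m x) = 0 -> S *m x = 0.
Proof.
move=> [ST S0] x0; apply: dot_self_eq0; set w := S *m x.
(* A step of length a c along - w; the 1 in b + 1 covers the case b = 0. *)
pose b := dot w (S *m w); pose a := dot w w; pose c := (b + 1)^-1.
have b0 : 0 <= b by exact: S0.
have c0 : 0 < c by rewrite invr_gt0 ltr_wpDl.
have cb : c * b = 1 - c.
  have : c * (b + 1) = 1 by rewrite mulVf// gt_eqF// ltr_wpDl.
  lra.
have := S0 (x + (- (a * c)) *: w).
rewrite quad_formD// x0 -scalemxAr !dotZr dotZl (dot_symm x w ST) -/w -/a -/b.
have -> : 0 + 2 * (- (a * c) * a) + - (a * c) * (- (a * c) * b) = - (a ^+ 2 * (c + c ^+ 2)).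
  transitivity (- 2 * a ^+ 2 * c + a ^+ 2 * c * (c * b)); first by ring.
  by rewrite cb; ring.
rewrite oppr_ge0 => h; have cc : 0 < c + c ^+ 2 by rewrite addr_gt0// exprn_gt0.
have : a ^+ 2 = 0.
  by apply/eqP; rewrite eq_le sqr_ge0 andbT -(ler_pM2r cc) mul0r.
by move/eqP; rewrite sqrf_eq0 => /eqP.
Qed.

Lemma psd_kernel_mx k l (S : 'M[R]_k) (Z : 'M[R]_(k, l)) : psd S ->
  Z^T *m S *m Z = 0 -> S *m Z = 0.
Proof.
move=> pS ZSZ; apply/matrixP => i j.
have : S *m (Z *m (delta_mx j 0 : 'cV[R]_l)) = 0.
  apply: psd_kernel => //; rewrite dotC dot_mulmx dotC (mulmxA S) (mulmxA Z^T) (mulmxA Z^T).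
  by rewrite ZSZ mul0mx dot0r.
by rewrite mulmxA -colE => /matrixP/(_ i 0); rewrite !mxE.
Qed.

Lemma psd_trace_diag k (S : 'M[R]_k) : psd S -> \tr S != 0 -> exists i, 0 < S i i.
Proof.
move=> [_ S0] trS; have Sii i : S i i = dot (delta_mx i 0) (S *m delta_mx i 0).
  by rewrite -colE dot_delta mxE.
apply: contrapT => Sle; move/eqP : trS; apply; rewrite /mxtrace big1// => i _.
apply/eqP; rewrite eq_le Sii S0 andbT -Sii leNgt; apply/negP => Si.
by apply: Sle; exists i.
Qed.

Lemma moore_penrose_trmx k (M G : 'M[R]_k) : M^T = M ->
  moore_penrose M G -> moore_penrose M G^T.
Proof.
move=> MT [e1 e2 e3 e4].
have a : M *m G^T = G *m M by rewrite -{1}MT -trmx_mul e4.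
have b : G^T *m M = M *m G by rewrite -{1}MT -trmx_mul e3.
split; [| |by rewrite a e4|by rewrite b e3].
- by have := congr1 trmx e1; rewrite !trmx_mul MT mulmxA.
- by have := congr1 trmx e2; rewrite !trmx_mul MT mulmxA.
Qed.

Section Regression.
Variables (k l : nat) (S : 'M[R]_k) (C : 'M[R]_(l, k)).
Hypothesis pS : psd S.
Local Notation M := (C *m S *m C^T).
Local Notation G := (mpinv M).

Lemma mpinv_symm : G^T = G.
Proof.
have [MT _] := psd_conj C pS.
apply: (@moore_penrose_uniq _ _ _ M); last exact: mpinvP.
by apply: moore_penrose_trmx => //; exact: mpinvP.
Qed.

(** The coefficients of the linear regression of a vector with covariance S on
its image under C. *)
Definition regression_mx : 'M[R]_(k, l) := S *m C^T *m G.
Local Notation K := regression_mx.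

(** The normal equations.  They hold even when M is singular: the columns of
C^T (1 - G M) are isotropic for S, hence in its kernel. *)
Lemma regression_mxM : K *m M = S *m C^T.
Proof.
have [MT _] := psd_conj C pS; have [e1 _ _ _] := mpinvP M.
apply/eqP; rewrite -subr_eq0 /regression_mx.
have -> : S *m C^T *m G *m M - S *m C^T = - (S *m (C^T *m (1%:M - G *m M))).
  by rewrite mulmxBr mulmx1 mulmxBr opprB !mulmxA.
rewrite oppr_eq0; apply/eqP; apply: psd_kernel_mx => //.
have -> : (C^T *m (1%:M - G *m M))^T *m S *m (C^T *m (1%:M - G *m M)) =
    (1%:M - G *m M)^T *m (M *m (1%:M - G *m M)) by rewrite trmx_mul trmxK !mulmxA.
by rewrite mulmxBr mulmx1 [M *m (G *m M)]mulmxA e1 subrr mulmx0.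
Qed.

Lemma regression_trmx : K^T = G *m C *m S.
Proof. by rewrite /regression_mx !trmx_mul trmxK mpinv_symm (proj1 pS) mulmxA. Qed.

Lemma regression_residual :
  (1%:M - K *m C) *m S *m (1%:M - K *m C)^T = S - K *m C *m S.
Proof.
have KMK : K *m C *m S *m (K *m C)^T = K *m C *m S.
  rewrite trmx_mul !mulmxA -(mulmxA K C) -(mulmxA K) regression_mxM regression_trmx.
  by rewrite /regression_mx !mulmxA.
have SKC : S *m (K *m C)^T = K *m C *m S.
  by rewrite trmx_mul regression_trmx /regression_mx !mulmxA.
rewrite linearB/= trmx1 mulmxBr mulmx1 mulmxBl mul1mx mulmxBl SKC KMK.
by rewrite subrr subr0.
Qed.

(** The variance of a's + b'(C s) is the sum of the variance of its best
prediction from C s and that of the residual. *)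
Lemma regression_quad_form (a : 'cV[R]_k) (b : 'cV[R]_l) :
  dot (K^T *m a + b) (M *m (K^T *m a + b)) +
    dot a ((1%:M - K *m C) *m S *m (1%:M - K *m C)^T *m a) =
  dot (a + C^T *m b) (S *m (a + C^T *m b)).
Proof.
have [MT _] := psd_conj C pS.
rewrite !quad_formD//; last by case: pS.
rewrite regression_residual.
have SCK : S *m C^T *m K^T = K *m C *m S by rewrite regression_trmx /regression_mx !mulmxA.
have -> : dot (K^T *m a) (M *m (K^T *m a)) = dot a (K *m C *m S *m a).
  by rewrite -dot_mulmx (mulmxA K) regression_mxM mulmxA SCK.
have -> : dot (K^T *m a) (M *m b) = dot a (S *m (C^T *m b)).
  by rewrite -dot_mulmx (mulmxA K) regression_mxM mulmxA.
have -> : dot b (M *m b) = dot (C^T *m b) (S *m (C^T *m b)).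
  by rewrite -dot_mulmx !mulmxA.
by rewrite mulmxBl dotDr dotNr; ring.
Qed.

End Regression.
End Psd.

Section MgfAffine.
Context {R : realType}.

Lemma mgf_affine k (N : {measure set 'cV[R]_k -> \bar R}) (u : 'cV[R]_k) (c : R) :
  (\int[N]_y (expR (c + dot u y))%:E = (expR c)%:E * mgf N u)%E.
Proof.
under eq_integral do rewrite expRD EFinM.
by rewrite ge0_integralZl//=; exact: measurable_expR_dot.
Qed.

End MgfAffine.

(** * A Gaussian vector does not charge spheres *)
Section NoAtom.
Context {R : realType}.
Local Notation Rm := (measurableTypeR R).

Lemma normal_prob_two_points (m s : R) (A : set Rm) (t1 t2 : R) : A `<=` [set t1; t2] ->
  normal_prob m s A = 0%E.
Proof.
move=> sA; have cA : countable A by apply: sub_countable (finite_set_countable (finite_set2 t1 t2)); exact: subset_card_le.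
have mA : measurable A by exact: countable_measurable.
have /null_content_dominatesP := @normal_prob_dominates R m s.
by move=> /(_ A mA (countable_lebesgue_measure0 cA)).
Qed.

Lemma quadratic_two_roots (a b c : R) : a != 0 ->
  exists t1 t2, [set t : R | a * t ^+ 2 + 2 * b * t = c] `<=` [set t1; t2].
Proof.
move=> a0; have [[t0 /= h0]|h] := pselect (exists t, a * t ^+ 2 + 2 * b * t = c).
  (* The sum of the two roots is - 2 b / a. *)
  exists t0, (- t0 - 2 * b / a) => t /= h.
  have : (t - t0) * (a * (t + t0) + 2 * b) = 0.
      have -> : (t - t0) * (a * (t + t0) + 2 * b) =
      (a * t ^+ 2 + 2 * b * t) - (a * t0 ^+ 2 + 2 * b * t0) by ring.
    by rewrite h h0 subrr.
  move/eqP; rewrite mulf_eq0 subr_eq0 => /orP[/eqP ->|/eqP e]; [by left|right].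
  have : t + t0 = - (2 * b / a).
    by apply: (mulfI a0); rewrite mulrN mulrCA divff// mulr1; apply/eqP; rewrite -addr_eq0 e.
  by move=> <-; ring.
by exists 0, 0 => t ht; exfalso; apply: h; exists t.
Qed.

Lemma sqnormE k (y : 'cV[R]_k) : sqnorm y = dot y y. Proof. by []. Qed.

(** Replaces by t the component of the vector along w, when w i = 1. *)
Definition recombine k (i : 'I_k) (w : 'cV[R]_k) (z : 'cV[R]_k * Rm) : 'cV[R]_k :=
  (z.2 : R) *: w + (z.1 - z.1 i 0 *: w).

Lemma measurable_recombine k i (w : 'cV[R]_k) : measurable_fun setT (recombine i w).
Proof.
apply: measurable_fun_mx => a b; under eq_fun do rewrite !mxE.
have m1 a' : measurable_fun setT (fun z : 'cV[R]_k * Rm => z.1 a' b).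
  by apply: measurable_entry; exact: measurable_fst.
rewrite ord1 in m1 *.
apply: measurable_funD; first by apply: measurable_funM => //; exact: measurable_snd.
by apply: measurable_funB => //; apply: measurable_funM.
Qed.

Lemma recombine_dot k i (w u y : 'cV[R]_k) (t : R) :
  dot u (recombine i w (y, t)) = dot u w * t + dot (u - dot u w *: delta_mx i 0) y.
Proof.
by rewrite /recombine /= dotDr dotZr dotDr dotNr dotZr dotDl dotNl dotZl dot_delta; ring.
Qed.

(** When w is the regression of y on its i-th entry, that entry is
independent of the rest of the decomposition, so that replacing it by an
independent copy does not change the law of y. *)
Lemma gaussian_split k (N : probability 'cV[R]_k R) (M : 'M[R]_k) i (w : 'cV[R]_k) (v : R) :
  M^T = M -> (forall u, mgf N u = (expR (dot u (M *m u) / 2))%:E) -> 0 < v ->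
  dot (delta_mx i 0) (M *m delta_mx i 0) = v ->
  (forall u, dot u (M *m delta_mx i 0) = v * dot u w) ->
  forall B, measurable B -> N B = (N \x normal_prob 0 (Num.sqrt v))%E (recombine i w @^-1` B).
Proof.
move=> MT NE v0 vi Mw B mB.
set s := Num.sqrt v; have s2 : s ^+ 2 = v by rewrite sqr_sqrtr// ltW.
have s0 : s != 0 by rewrite -sqrf_eq0 s2 gt_eqF.
pose n : probability Rm R := normal_prob 0 s.
have mphi := measurable_recombine i w.
have e2 u : mgf (image_measure (N \x n)%E mphi) u = (expR (dot u (M *m u) / 2))%:E.
  rewrite /mgf (ge0_integral_image _ mphi (measurable_expR_dot u) (expR_dot_ge0 u)).
  rewrite fubini_tonelli1; first last.
  - by move=> z; exact: expR_dot_ge0.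
  - by apply/measurable_EFinP; apply: measurableT_comp => //; exact: measurable_dot.
  rewrite /fubini_F /=.
  have inner y : (\int[n]_t (expR (dot u (recombine i w (y, t))))%:E =
      (expR (dot u w ^+ 2 * v / 2 + dot (u - dot u w *: delta_mx i 0) y))%:E)%E.
    under eq_integral do rewrite recombine_dot expRD EFinM.
    have me := measurable_expRM (dot u w).
    by rewrite ge0_integralZr// normal_prob_mgf// s2 mulr0 add0r -EFinM -expRD.
  under eq_integral do rewrite inner.
  rewrite mgf_affine NE -EFinM -expRD -scaleNr quad_formD//; congr (expR _)%:E.
  by rewrite -scalemxAr !dotZr dotZl vi Mw; field.
exact: (eq_measure_mgf NE e2 mB).
Qed.

(** A nonzero covariance matrix has a positive diagonal entry M i i.  With the
rest of the decomposition of [gaussian_split] fixed, sqnorm y = c is a quadratic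
equation in the i-th entry, with leading coefficient sqnorm w > 0: it has at
most two solutions. *)
Lemma gaussian_sphere0 k (N : probability 'cV[R]_k R) (M : 'M[R]_k) (c : R) :
  psd M -> \tr M != 0 -> (forall u, mgf N u = (expR (dot u (M *m u) / 2))%:E) ->
  N [set y | sqnorm y = c] = 0%E.
Proof.
move=> pM trM NE; have [i v0] := psd_trace_diag pM trM.
pose w : 'cV[R]_k := (M i i)^-1 *: (M *m delta_mx i 0).
have vi : dot (delta_mx i 0) (M *m delta_mx i 0) = M i i by rewrite -colE dot_delta mxE.
have Mw u : dot u (M *m delta_mx i 0) = M i i * dot u w.
  by rewrite dotZr mulrA divff ?mul1r// gt_eqF.
have ww : sqnorm w != 0.
  apply/eqP => /dot_self_eq0 w0; move: (Mw (delta_mx i 0)).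
  by rewrite vi w0 dot0r mulr0 => Mii; rewrite Mii ltxx in v0.
have mB : measurable [set y : 'cV[R]_k | sqnorm y = c].
  have := measurable_sqnorm (@measurable_id _ 'cV[R]_k setT) measurableT (measurable_set1 c).
  by rewrite setTI.
rewrite (gaussian_split (proj1 pM) NE v0 vi Mw mB) /product_measure1.
clearbody w; apply: integral0_eq => y _ /=.
pose y' := y - y i 0 *: w.
have [t1 [t2 ht]] := quadratic_two_roots (dot w y') (c - sqnorm y') ww.
apply: (@normal_prob_two_points _ _ _ t1 t2) => t /xsectionP /= e; apply: ht => /=.
rewrite -e /recombine /= -/y' !sqnormE; clearbody y'.
by rewrite !dotDl !dotDr !dotZl !dotZr (dotC y' w); ring.
Qed.

End NoAtom.

(** * Randomisation kernels *)
Section ImageKernel.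
Context {R : realType} d d1 d2 {T : measurableType d} {Y : measurableType d1} {Z : measurableType d2}.
Variables (P : probability T R) (phi : Y * T -> Z).
Hypothesis mphi : measurable_fun setT phi.

Definition image_kernel (y : Y) : {measure set Z -> \bar R} :=
  image_measure P (measurable_fun_pair2 y mphi).

Let measurable_image_kernel U : measurable U -> measurable_fun setT (image_kernel ^~ U).
Proof.
move=> mU; have mB : measurable (phi @^-1` U) by rewrite -[X in measurable X]setTI; exact: mphi.
have := measurable_fun_xsection P mB; congr (measurable_fun _ _).
apply/funext => y; rewrite /= /image_kernel; congr (P _).
by apply/seteqP; split=> t /=; rewrite /xsection /= inE.
Qed.

HB.instance Definition _ := isKernel.Build _ _ _ _ R image_kernel measurable_image_kernel.

Let image_kernel_prob y : image_kernel y setT = 1%E.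
Proof. exact: (probability_setT P). Qed.

HB.instance Definition _ := Kernel_isProbability.Build _ _ _ _ R image_kernel image_kernel_prob.

End ImageKernel.

(** * Limits of matrices and vanishing sequences *)
Section MatrixLimits.
Context {R : realType} {T : Type} {F : set_system T} {FF : Filter F}.

Lemma cvg_mx m n (f : T -> 'M[R]_(m, n)) (l : 'M[R]_(m, n)) :
  (forall i j, f t i j @[t --> F] --> l i j) -> f t @[t --> F] --> l.
Proof.
move=> fl A [P lP PA]; apply: (@filterS _ F _ (fun t => forall ij, P ij.1 ij.2 (f t ij.1 ij.2))).
  by move=> t h; apply: PA => i j; exact: (h (i, j)).
by apply: filter_forall => -[i j]; apply: fl; exact: lP.
Qed.

Lemma cvg_entry m n (f : T -> 'M[R]_(m, n)) (l : 'M[R]_(m, n)) i j :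
  f t @[t --> F] --> l -> f t i j @[t --> F] --> l i j.
Proof. by move=> fl; apply: (cvg_comp f (fun M : 'M[R]_(m, n) => M i j) fl); exact: (@coord_continuous R m n i j l). Qed.

Lemma cvg_sum_seq I (s : seq I) (f : T -> I -> R) (l : I -> R) :
  (forall i, f t i @[t --> F] --> l i) ->
  \sum_(i <- s) f t i @[t --> F] --> \sum_(i <- s) l i.
Proof.
move=> fl; elim: s => [|i s IHs].
  by rewrite big_nil; under eq_fun do rewrite big_nil; exact: cvg_cst.
by rewrite big_cons; under eq_fun do rewrite big_cons; exact: cvgD.
Qed.

Lemma cvg_mulmx m n k (f : T -> 'M[R]_(m, n)) (g : T -> 'M[R]_(n, k))
    (a : 'M[R]_(m, n)) (b : 'M[R]_(n, k)) :
  f t @[t --> F] --> a -> g t @[t --> F] --> b -> f t *m g t @[t --> F] --> a *m b.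
Proof.
move=> fa gb; apply: cvg_mx => i j; rewrite mxE; under eq_fun do rewrite mxE.
by apply: cvg_sum_seq => l; apply: cvgM; exact: cvg_entry.
Qed.

Lemma cvg_mulmxl m n k (M : 'M[R]_(m, n)) (g : T -> 'M[R]_(n, k)) (b : 'M[R]_(n, k)) :
  g t @[t --> F] --> b -> M *m g t @[t --> F] --> M *m b.
Proof. by move=> gb; apply: cvg_mulmx => //; exact: cvg_cst. Qed.

Lemma cvg_trmx m n (f : T -> 'M[R]_(m, n)) (a : 'M[R]_(m, n)) :
  f t @[t --> F] --> a -> (f t)^T @[t --> F] --> a^T.
Proof.
by move=> fa; apply: cvg_mx => i j; rewrite mxE; under eq_fun do rewrite mxE; exact: cvg_entry.
Qed.

Lemma cvg_dot k (f g : T -> 'cV[R]_k) (a b : 'cV[R]_k) :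
  f t @[t --> F] --> a -> g t @[t --> F] --> b -> dot (f t) (g t) @[t --> F] --> dot a b.
Proof. by move=> fa gb; apply: cvg_entry; apply: cvg_mulmx => //; exact: cvg_trmx. Qed.

Lemma cvg_usubmx m1 m2 n (f : T -> 'M[R]_(m1 + m2, n)) (a : 'M[R]_(m1 + m2, n)) :
  f t @[t --> F] --> a -> usubmx (f t) @[t --> F] --> usubmx a.
Proof.
by move=> fa; apply: cvg_mx => i j; rewrite mxE; under eq_fun do rewrite mxE; exact: cvg_entry.
Qed.

Lemma cvg_dsubmx m1 m2 n (f : T -> 'M[R]_(m1 + m2, n)) (a : 'M[R]_(m1 + m2, n)) :
  f t @[t --> F] --> a -> dsubmx (f t) @[t --> F] --> dsubmx a.
Proof.
by move=> fa; apply: cvg_mx => i j; rewrite mxE; under eq_fun do rewrite mxE; exact: cvg_entry.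
Qed.

Lemma cvg_col_mx m1 m2 n (f : T -> 'M[R]_(m1, n)) (g : T -> 'M[R]_(m2, n))
    (a : 'M[R]_(m1, n)) (b : 'M[R]_(m2, n)) :
  f t @[t --> F] --> a -> g t @[t --> F] --> b ->
  col_mx (f t) (g t) @[t --> F] --> col_mx a b.
Proof.
move=> fa gb; apply: cvg_mx => i j; case: (split_ordP i) => l ->.
  by rewrite col_mxEu; under eq_fun do rewrite col_mxEu; exact: cvg_entry.
by rewrite col_mxEd; under eq_fun do rewrite col_mxEd; exact: cvg_entry.
Qed.

Lemma cvg_minr (f : T -> R) a c :
  f t @[t --> F] --> a -> Num.min (f t) c @[t --> F] --> Num.min a c.
Proof.
have minE x : Num.min x c = 2^-1 * (x + c - `|x - c|).
  by case: (leP x c) => xc; [rewrite ler0_norm ?subr_le0//|rewrite gtr0_norm ?subr_gt0//]; field.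
move=> fa; rewrite minE; under eq_fun do rewrite minE.
apply: cvgMr; apply: cvgB; first by apply: cvgD => //; exact: cvg_cst.
by apply: cvg_norm; apply: cvgB => //; exact: cvg_cst.
Qed.

End MatrixLimits.

Section Vanishing.
Context {R : realType} {d : nat -> measure_display} {X : forall n, measurableType (d n)}.
Variable P : forall n, probability (X n) R.

(** Convergence to 0 in probability.  The norms, rather than the vectors, are
required to be measurable: W is any normed module, without a sigma-algebra. *)
Definition vanishing (W : normedModType R) (V : forall n, X n -> W) : Prop :=
  (forall n, measurable_fun setT (fun x => `|V n x|)) /\
  forall a, 0 < a -> P n [set x | a < `|V n x|] @[n --> \oo] --> 0%E.

Let measurable_gt n (f : X n -> R) a : measurable_fun setT f -> measurable [set x | a < f x].
Proof. by move=> mf; rewrite -[X in measurable X]setTI; exact: measurable_fun_ltr. Qed.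

Lemma vanishing_pair (W W' : normedModType R) (V : forall n, X n -> W) (V' : forall n, X n -> W') :
  vanishing V -> vanishing V' -> vanishing (fun n x => (V n x, V' n x)).
Proof.
move=> [mV V0] [mV' V0']; split=> [n|a a0].
  under eq_fun do rewrite prod_normE /=.
  by apply: measurable_maxr.
apply: (@squeeze_cvge _ _ _ _ (cst 0%E) _
  (fun n => P n [set x | (a < `|V n x|)%R] + P n [set x | (a < `|V' n x|)%R])%E).
- apply: nearW => n; rewrite measure_ge0/=.
  have -> : [set x | a < `|(V n x, V' n x)|] =
      [set x | a < `|V n x|] `|` [set x | a < `|V' n x|].
    apply/seteqP; split=> x; rewrite /= prod_normE/= lt_max; first by move/orP.
    by move=> h; apply/orP.
  by apply: measureU2; exact: measurable_gt.
- exact: cvg_cst.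
- by rewrite -[X in _ --> X]adde0; apply: cvgeD => //; [exact: V0|exact: V0'].
Qed.

Lemma vanishing_cst (W : normedModType R) (v : nat -> W) :
  v n @[n --> \oo] --> 0 -> vanishing (fun n (_ : X n) => v n).
Proof.
move=> v0; split=> [n|a a0]; first exact: measurable_cst.
apply: cvg_near_cst; move/cvgr0Pnorm_le : v0 => /(_ _ a0); apply: filterS => n vna.
suff -> : [set x : X n | a < `|v n|] = set0 by exact: measure0.
by apply/seteqP; split=> x //=; rewrite ltNge vna.
Qed.

Lemma mx_norm_le_enorm k (v : 'cV[R]_k) : `|v| <= enorm v.
Proof.
rewrite [leLHS](mx_normE v) -[leRHS]/(Num.sqrt (sqnorm v)).
have e0 : 0 <= Num.sqrt (sqnorm v) by exact: sqrtr_ge0.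
rewrite -[leRHS]/((NngNum e0)%:num) num_le; apply/bigmax_leP; split=> //= ij _.
rewrite -num_le /= -sqrtr_sqr ler_sqrt; last exact: dot_self_ge0.
rewrite [leRHS]dotE (bigD1 ij.1)//= (ord1 ij.2) expr2 lerDl sumr_ge0// => i _.
by rewrite -expr2 sqr_ge0.
Qed.

Lemma vanishing_oP1 k (V : forall n, X n -> 'cV[R]_k) :
  (forall n, measurable_fun setT (V n)) -> oP1_vec P V -> vanishing V.
Proof.
move=> mV oV; split=> [n|a a0]; first exact: measurable_norm_mx.
apply: (@squeeze_cvge _ _ _ _ (cst 0%E) _ (fun n => P n [set x | (a%:E < `|(enorm (V n x))%:E|)%E])).
- apply: nearW => n; rewrite measure_ge0/=.
  have men : measurable_fun setT (fun x => `|enorm (V n x)|).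
    apply: measurableT_comp => //; rewrite /enorm.
    apply: (measurableT_comp (f := @Num.sqrt R)); last exact: measurable_sqnorm.
    by apply: continuous_measurable_fun; exact: sqrt_continuous.
  apply: le_measure; rewrite ?inE; [|exact: measurable_gt|].
    by apply: measurable_gt; exact: measurable_norm_mx.
  move=> x /= ax; rewrite lte_fin (lt_le_trans ax)// (le_trans (mx_norm_le_enorm _))//.
  exact: ler_norm.
- exact: cvg_cst.
- exact: oV.
Qed.

End Vanishing.

Section ContinuityAt.
Context {R : realType} {k : nat} {W : normedModType R}.

Lemma cont_at0_cvg (F : 'cV[R]_k -> W -> R) z :
  F t.1 t.2 @[t --> (z, 0 : W)] --> F z 0 -> cont_at0 F z.
Proof.
move=> cF e e0; move/cvgrPdist_lt : cF => /(_ _ e0) /nbhs_ballP[a /= a0 h].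
exists a => // z' v zz v0; rewrite distrC; apply: (h (z', v)); split=> /=.
  by rewrite -ball_normE /= distrC.
by rewrite -ball_normE /= sub0r normrN.
Qed.

End ContinuityAt.

(** * Weak convergence from lower bounds *)
Section WeakFromLiminf.
Context {R : realType} {d : nat -> measure_display} {X : forall n, measurableType (d n)}.

(** When |f| <= K, both K + f and K - f are nonnegative; their lower bounds
enclose the expectations of f. *)
Lemma weak_cvg_liminf (Q : forall n, probability (X n) R) k (Y : forall n, X n -> 'cV[R]_k)
    d' (T : measurableType d') (P : probability T R) (Z : T -> 'cV[R]_k) :
  (forall n, measurable_fun setT (Y n)) -> measurable_fun setT Z ->
  (forall (g : 'cV[R]_k -> R) K, continuous g -> (forall y, 0 <= g y <= K) ->
    forall e, 0 < e -> \forall n \near \oo,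
      \int[P]_w g (Z w) - e <= \int[Q n]_x g (Y n x)) ->
  weak_cvg Q Y P Z.
Proof.
move=> mY mZ H f cf [B [_ fB]].
(* Boundedness of f bounds |f| by every number above B; K is such a number. *)
pose K := `|B| + 1.
have fK y : `|f y| <= K by apply: (fB K) => //; rewrite (le_lt_trans (ler_norm B))// ltrDl.
have mf := continuous_measurable_mx cf.
have iP : P.-integrable setT (EFin \o (f \o Z)).
  by apply: (bounded_integrable P (B := K)) => [|w]; [exact: measurableT_comp|exact: fK].
have iQ n : (Q n).-integrable setT (EFin \o (f \o Y n)).
  by apply: (bounded_integrable (Q n) (B := K)) => [|w]; [exact: measurableT_comp|exact: fK].
suff : \int[Q n]_x f (Y n x) @[n --> \oo] --> \int[P]_w f (Z w).
  move=> h.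
  rewrite -[X in _ --> X](fineK (integrable_fin_num measurableT iP)).
  rewrite (_ : (fun n => _) = (fun n => (\int[Q n]_x f (Y n x))%:E)).
    by apply: cvg_EFin; [exact: nearW|exact: h].
  by apply/funext => n; rewrite fineK//; exact: (integrable_fin_num measurableT (iQ n)).
have EK d0 (T0 : measurableType d0) (m : probability T0 R) (h : T0 -> R) s :
    m.-integrable setT (EFin \o h) ->
    \int[m]_x (K + (-1) ^+ s * h x) = K + (-1) ^+ s * \int[m]_x h x.
  move=> ih; have ish : m.-integrable setT (EFin \o (fun x => (-1) ^+ s * h x)).
    by have := integrableZl measurableT ((-1) ^+ s) ih; apply: eq_integrable => // x _; rewrite /= EFinM.
  rewrite RintegralD//; last exact: finite_measure_integrable_cst.
  by rewrite Rintegral_cst_prob RintegralZl.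
have side s e : 0 < e -> \forall n \near \oo,
    (-1) ^+ s * \int[P]_w f (Z w) - e <= (-1) ^+ s * \int[Q n]_x f (Y n x).
  move=> e0; have cg : continuous (fun y => K + (-1) ^+ s * f y).
    move=> y; apply: (@cvgD _ R^o _ (nbhs y) _ (fun=> K) (fun y => (-1) ^+ s * f y)).
      exact: (@cvg_cst R^o).
    by apply: cvgMr; exact: cf.
  have g01 y : 0 <= K + (-1) ^+ s * f y <= 2 * K.
    have : `|(-1) ^+ s * f y| <= K by rewrite normrM normrX normrN1 expr1n mul1r.
    by rewrite ler_norml; lra.
  have := H _ _ cg g01 e e0; apply: filterS => n.
  by rewrite (EK _ _ P (f \o Z) s iP) (EK _ _ (Q n) (f \o Y n) s (iQ n)); lra.
apply/cvgrPdist_le => e e0; have := side 0%N e e0; have := side 1%N e e0.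
apply: filterS2 => n; rewrite expr0 expr1 !mul1r !mulN1r ler_norml => h1 h2.
by apply/andP; split; lra.
Qed.

End WeakFromLiminf.

(** * The preliminary test estimator as a function of score and remainders *)

(** In this part z stands for (S, Delta) and v for the quadruple made of
tau_n - tau, the remainders in the expansions of the two estimators, and the
remainder in that of the test statistic; UB stands for Upsilon B. *)
Section PreliminaryTest.
Context {R : realType} {p : nat}.
Variables (A UB C Gam : 'M[R]_p) (tau : 'cV[R]_p) (c : R).
Local Notation W := ('cV[R]_p * 'cV[R]_p * 'cV[R]_p * 'cV[R]_p)%type.
Implicit Types (z : 'cV[R]_(p + p)) (v : W).

Definition stat_test z v : 'cV[R]_p := C *m usubmx z + v.2.

Definition stat_branch (b : bool) z v : 'cV[R]_p :=
  (if b then A *m usubmx z + v.1.1.2 else UB *m usubmx z + v.1.2) - (tau + v.1.1.1).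

Definition stat_pte z v : 'cV[R]_(p + p) :=
  col_mx (stat_branch (c < sqnorm (stat_test z v)) z v) (stat_test z v).

Definition log_weight z v : R :=
  dot (tau + v.1.1.1) (dsubmx z) -
  2^-1 * dot (tau + v.1.1.1) (Gam *m (tau + v.1.1.1)).

Section Continuity.
Variable x : 'cV[R]_(p + p) * W.

Let cz : t.1 @[t --> x] --> x.1.
Proof. exact: cvg_fst. Qed.

Let cv : t.2 @[t --> x] --> x.2.
Proof. exact: cvg_snd. Qed.

Let cv1 : t.2.1 @[t --> x] --> x.2.1.
Proof. exact: (cvg_comp _ _ cv (@cvg_fst _ _ _ _ _)). Qed.

Let cv11 : t.2.1.1 @[t --> x] --> x.2.1.1.
Proof. exact: (cvg_comp _ _ cv1 (@cvg_fst _ _ _ _ _)). Qed.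

Let ctau : tau + t.2.1.1.1 @[t --> x] --> tau + x.2.1.1.1.
Proof.
apply: cvgD; first exact: cvg_cst.
exact: (cvg_comp _ _ cv11 (@cvg_fst _ _ _ _ _)).
Qed.

Lemma cvg_stat_test : stat_test t.1 t.2 @[t --> x] --> stat_test x.1 x.2.
Proof.
apply: cvgD; first by apply: cvg_mulmxl; apply: cvg_usubmx; exact: cz.
exact: (cvg_comp _ _ cv (@cvg_snd _ _ _ _ _)).
Qed.

Lemma cvg_stat_branch b : stat_branch b t.1 t.2 @[t --> x] --> stat_branch b x.1 x.2.
Proof.
apply: cvgB; last exact: ctau.
case: b; apply: cvgD.
- by apply: cvg_mulmxl; apply: cvg_usubmx; exact: cz.
- exact: (cvg_comp _ _ cv11 (@cvg_snd _ _ _ _ _)).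
- by apply: cvg_mulmxl; apply: cvg_usubmx; exact: cz.
- exact: (cvg_comp _ _ cv1 (@cvg_snd _ _ _ _ _)).
Qed.

Lemma cvg_log_weight : log_weight t.1 t.2 @[t --> x] --> log_weight x.1 x.2.
Proof.
apply: cvgB; first by apply: cvg_dot; [exact: ctau|apply: cvg_dsubmx; exact: cz].
by apply: cvgMr; apply: cvg_dot; [exact: ctau|apply: cvg_mulmxl; exact: ctau].
Qed.

(** Off the critical sphere the outcome of the test is locally constant. *)
Lemma cvg_stat_pte : sqnorm (stat_test x.1 x.2) != c ->
  stat_pte t.1 t.2 @[t --> x] --> stat_pte x.1 x.2.
Proof.
move=> xc; set b := c < sqnorm (stat_test x.1 x.2).
have cb : col_mx (stat_branch b t.1 t.2) (stat_test t.1 t.2) @[t --> x] -->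
    stat_pte x.1 x.2.
  by apply: cvg_col_mx; [exact: cvg_stat_branch|exact: cvg_stat_test].
apply: cvg_trans cb; apply: near_eq_cvg.
have cs : sqnorm (stat_test t.1 t.2) @[t --> x] --> sqnorm (stat_test x.1 x.2).
  by apply: cvg_dot; exact: cvg_stat_test.
have : \forall t \near x, (c < sqnorm (stat_test t.1 t.2)) = b.
  rewrite /b; case: ltgtP xc => // sc _.
    have /cvgr_gt := cs; move=> /(_ _ sc); apply: filterS => t; by move=> ->.
  have /cvgr_lt := cs; move=> /(_ _ sc); apply: filterS => t tc.
  by apply/negbTE; rewrite -leNgt ltW.
by apply: filterS => t tb; rewrite /stat_pte tb.
Qed.

End Continuity.

Section Measurability.
Context d (T : measurableType d) (z : T -> 'cV[R]_(p + p)) (t R1 R2 R3 : T -> 'cV[R]_p).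
Hypotheses (mz : measurable_fun setT z) (mt : measurable_fun setT t)
  (mR1 : measurable_fun setT R1) (mR2 : measurable_fun setT R2)
  (mR3 : measurable_fun setT R3).

Lemma measurable_stat_pte :
  measurable_fun setT (fun x => stat_pte (z x) (t x, R1 x, R2 x, R3 x)).
Proof.
have mtest : measurable_fun setT (fun x => stat_test (z x) (t x, R1 x, R2 x, R3 x)).
  by apply: measurable_addmx => //; apply: measurable_mulmxl; exact: measurable_usubmx.
apply: measurable_col_mx => //; rewrite /stat_branch/=.
apply: measurable_submx; last by apply: measurable_addmx.
apply: measurable_fun_ifT.
- by apply: measurable_fun_ltr => //; exact: measurable_sqnorm.
- by apply: measurable_addmx => //; apply: measurable_mulmxl; exact: measurable_usubmx.
- by apply: measurable_addmx => //; apply: measurable_mulmxl; exact: measurable_usubmx.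
Qed.

Lemma measurable_log_weight :
  measurable_fun setT (fun x => log_weight (z x) (t x, R1 x, R2 x, R3 x)).
Proof.
have mtt : measurable_fun setT (fun x => tau + t x) by exact: measurable_addmx.
have md (f g : T -> 'cV[R]_p) : measurable_fun setT f -> measurable_fun setT g ->
    measurable_fun setT (fun x => dot (f x) (g x)).
  move=> mf mg; under eq_fun do rewrite dotE.
  by apply: measurable_sum => i; apply: measurable_funM; exact: measurable_entry.
apply: measurable_funB; first by apply: md => //; exact: measurable_dsubmx.
by apply: measurable_funM => //; apply: md => //; exact: measurable_mulmxl.
Qed.

End Measurability.

Section LeCamPte.
Context {d : nat -> measure_display} {X : forall n, measurableType (d n)}.

(** The truncation level M is chosen first, so that truncating the limiting
weight costs at most e / 2; then [liminf_mapping] and [lecam_liminf] apply to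
the bounded function obtained. *)
Lemma lecam_pte (P Q : forall n, probability (X n) R) (Y : forall n, X n -> 'cV[R]_(p + p))
    (t : nat -> 'cV[R]_p) (R1 R2 R3 : forall n, X n -> 'cV[R]_p)
    (N : probability 'cV[R]_(p + p) R) (g : 'cV[R]_(p + p) -> R) (K : R) :
  (forall n, measurable_fun setT (Y n)) -> (forall n, measurable_fun setT (R1 n)) ->
  (forall n, measurable_fun setT (R2 n)) -> (forall n, measurable_fun setT (R3 n)) ->
  weak_cvg P Y N id -> t n @[n --> \oo] --> (0 : 'cV[R]_p) ->
  oP1_vec P R1 -> oP1_vec P R2 -> oP1_vec P R3 ->
  oP1 P (fun n x => (log_likelihood_ratio (Q n) (P n) x -
    (log_weight (Y n x) (t n, R1 n x, R2 n x, R3 n x))%:E)%E) ->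
  N [set z | sqnorm (C *m usubmx z) = c] = 0%E ->
  N.-integrable setT (EFin \o (fun z => expR (log_weight z 0))) ->
  continuous g -> (forall y, 0 <= g y <= K) ->
  forall e, 0 < e -> \forall n \near \oo,
    \int[N]_z (g (stat_pte z 0) * expR (log_weight z 0)) - e <=
    \int[Q n]_x g (stat_pte (Y n x) (t n, R1 n x, R2 n x, R3 n x)).
Proof.
move=> mY mR1 mR2 mR3 YN t0 oR1 oR2 oR3 llr sphere0 iw cg gK e e0.
have mg := continuous_measurable_mx cg.
have K0 : 0 <= K by have /andP[] := gK 0; exact: le_trans.
have mstat n := measurable_stat_pte (mY n) (@measurable_cst _ _ _ _ setT (t n)) (mR1 n) (mR2 n) (mR3 n).
have mlw n := measurable_log_weight (R1 n) (R2 n) (R3 n) (mY n)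
  (@measurable_cst _ _ _ _ setT (t n)).
have mid := @measurable_id _ 'cV[R]_(p + p) setT.
have m0 := @measurable_cst _ _ 'cV[R]_(p + p) 'cV[R]_p setT 0.
have mstat0 : measurable_fun setT (fun z => stat_pte z 0) := measurable_stat_pte mid m0 m0 m0 m0.
have mlw0 : measurable_fun setT (fun z => log_weight z 0) := measurable_log_weight (cst 0) (cst 0) (cst 0) mid m0.
(* The integrand with the likelihood ratio truncated at M. *)
pose FM M z v := g (stat_pte z v) * Num.min (expR (log_weight z v)) M.
have FMK M z v : 0 <= M -> `|FM M z v| <= K * M.
  move=> M0; have /andP[g0 g1] := gK (stat_pte z v).
  rewrite ger0_norm; last by rewrite mulr_ge0// le_min expR_ge0.
  by rewrite ler_pM ?le_min ?expR_ge0// ge_min lexx orbT.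
have mFM M d' (T : measurableType d') (f : T -> 'cV[R]_(p + p)) (h : T -> R) :
    measurable_fun setT f -> measurable_fun setT h ->
    measurable_fun setT (fun x => g (f x) * Num.min (expR (h x)) M).
  move=> mf mh; apply: measurable_funM; first exact: measurableT_comp.
  by apply: measurable_minr => //; exact: measurableT_comp.
have FM_cvg : \int[N]_z FM n%:R z 0 @[n --> \oo] -->
    \int[N]_z (g (stat_pte z 0) * expR (log_weight z 0)).
  apply: (proj2 (@dominated_Rintegral R _ _ N (fun n z => FM n%:R z 0)
      (fun z => g (stat_pte z 0) * expR (log_weight z 0))
      (fun z => K * expR (log_weight z 0)) _ _ _ _)).
  - by move=> n; exact: mFM.
  - by have := integrableZl measurableT K iw; apply: eq_integrable => // z _; rewrite /= EFinM.
  - move=> n z; have /andP[g0 g1] := gK (stat_pte z 0).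
    rewrite ger0_norm; last by rewrite mulr_ge0// le_min expR_ge0/=.
    by rewrite ler_pM ?le_min ?expR_ge0//= ge_min lexx.
  move=> z; apply: cvgMr; apply: cvg_near_cst; near=> n.
  apply/min_idPl; near: n; exact: nbhs_infty_ger.
have e20 : 0 < e / 2 by rewrite divr_gt0.
have /cvgrPdist_le/(_ _ e20)[m _ /(_ m (leqnn m)) /=] := FM_cvg.
rewrite ler_norml => /andP[_ Hm].
have lim := @lecam_liminf R d X P Q
  (fun n x => log_weight (Y n x) (t n, R1 n x, R2 n x, R3 n x))
  (fun n x => g (stat_pte (Y n x) (t n, R1 n x, R2 n x, R3 n x)))
  K m%:R (\int[N]_z FM m%:R z 0) llr mlw _ _ _ _ (e / 2) e20.
suff : \forall n \near \oo, \int[N]_z FM m%:R z 0 - e / 2 <=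
    \int[Q n]_x g (stat_pte (Y n x) (t n, R1 n x, R2 n x, R3 n x)).
  by apply: filterS => n; lra.
apply: lim => //.
- by move=> n; apply: (measurableT_comp mg); exact: mstat.
have [mV V0] : vanishing P (fun n x => (t n, R1 n x, R2 n x, R3 n x)).
  apply: vanishing_pair; last exact: vanishing_oP1.
  apply: vanishing_pair; last exact: vanishing_oP1.
  apply: vanishing_pair; last exact: vanishing_oP1.
  exact: vanishing_cst.
move=> a a0; apply: (@liminf_mapping _ _ _ P _ Y N _ (fun n x => (t n, R1 n x, R2 n x, R3 n x))
  (FM m%:R) (K * m%:R)) => //.
- by move=> z v; exact: FMK.
- by move=> n; exact: mFM.
- exact: mFM.
exists [set z | sqnorm (C *m usubmx z) = c]; split => //.
  have mu : measurable_fun setT (fun z : 'cV[R]_(p + p) => sqnorm (C *m usubmx z)).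
    by apply: measurable_sqnorm; apply: measurable_mulmxl; exact: measurable_usubmx.
  by have := mu measurableT _ (measurable_set1 c); rewrite setTI.
move=> z /= nz; apply: contrapT => zc; apply: nz; apply: cont_at0_cvg.
have zc' : sqnorm (stat_test z 0) != c by apply/eqP; rewrite /stat_test addr0.
rewrite /FM; apply: cvgM.
  apply: (cvg_comp _ _ (@cvg_stat_pte (z, 0) zc')); exact: cg.
apply: cvg_minr; apply: (cvg_comp _ _ (@cvg_log_weight (z, 0))).
exact: continuous_expR.
Unshelve. all: by end_near.
Qed.

End LeCamPte.
End PreliminaryTest.

(** * The Gaussian limit under local alternatives *)
Section GaussianBlock.
Context {R : realType} {p : nat}.
Variables (S O G : 'M[R]_p) (N : probability 'cV[R]_(p + p) R).
Hypothesis gN : mvnormal N 0 (block_mx S O O^T G).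

Lemma dot_col_mx k l (a : 'cV[R]_k) (b : 'cV[R]_l) z :
  dot (col_mx a b) z = dot a (usubmx z) + dot b (dsubmx z).
Proof. by rewrite /dot tr_col_mx -[z in LHS]vsubmxK mul_row_col mxE. Qed.

Lemma mvnormal_block_psd : psd S.
Proof.
have [VT V0] := mvnormal_psd gN.
have ST : S^T = S by move: VT; rewrite tr_block_mx => /eq_block_mx[].
split=> // x; have := V0 (col_mx x 0).
by rewrite mul_block_col dot_col_mx col_mxKu !mulmx0 dot0l !addr0.
Qed.

Lemma mvnormal_block_mgf (c : R) (a b : 'cV[R]_p) :
  (\int[N]_z (expR (c + (dot a (usubmx z) + dot b (dsubmx z))))%:E =
   (expR (c + (dot a (S *m a) + 2 * dot a (O *m b) + dot b (G *m b)) / 2))%:E)%E.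
Proof.
under eq_integral do rewrite -dot_col_mx.
rewrite mgf_affine (mvnormal_mgf gN) dot0r add0r -EFinM -expRD.
rewrite mul_block_col dot_col_mx col_mxKu col_mxKd !dotDr.
have -> : dot b (O^T *m a) = dot a (O *m b) by rewrite dot_mulmx trmxK dotC.
by congr (expR (_ + _ / 2))%:E; ring.
Qed.

Lemma mvnormal_block_mgf1 (c : R) (a : 'cV[R]_p) :
  (\int[N]_z (expR (c + dot a (usubmx z)))%:E = (expR (c + dot a (S *m a) / 2))%:E)%E.
Proof.
have := mvnormal_block_mgf c a 0.
rewrite !mulmx0 dot0r dot0l mulr0 !addr0 => <-.
by apply: eq_integral => z _; rewrite dot0l addr0.
Qed.

Lemma measurable_affine_usubmx k (m : 'cV[R]_k) (B : 'M[R]_(k, p)) :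
  measurable_fun setT (fun z : 'cV[R]_(p + p) => m + B *m usubmx z).
Proof.
apply: measurable_addmx; first exact: measurable_cst.
by apply: measurable_mulmxl; apply: measurable_usubmx; exact: measurable_id.
Qed.

Lemma mvnormal_affine k (m : 'cV[R]_k) (B : 'M[R]_(k, p)) :
  mvnormal (image_measure N (measurable_affine_usubmx m B)) m (B *m S *m B^T).
Proof.
have pS := mvnormal_block_psd; have [BT B0] := psd_conj B pS.
apply: mgf_mvnormal => // u.
rewrite /mgf (ge0_integral_image N _ (measurable_expR_dot u) (expR_dot_ge0 u)).
under eq_integral do rewrite dotDr [dot u (B *m _)]dot_mulmx.
by rewrite mvnormal_block_mgf1 -!mulmxA -dot_mulmx.
Qed.

Lemma mvnormal_sphere0 (C : 'M[R]_p) c : \tr (C^T *m C *m S) != 0 ->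
  N [set z | sqnorm (C *m usubmx z) = c] = 0%E.
Proof.
move=> trC; have mf := measurable_affine_usubmx 0 C.
pose f : {mfun 'cV[R]_(p + p) >-> 'cV[R]_p} := mfun_Sub (mem_set mf).
have pM := psd_conj C mvnormal_block_psd.
have trM : \tr (C *m S *m C^T) != 0 by rewrite mxtrace_mulC mulmxA.
have -> : [set z | sqnorm (C *m usubmx z) = c] = f @^-1` [set y | sqnorm y = c].
  by apply/seteqP; split=> z; rewrite /f /= add0r.
apply: (gaussian_sphere0 (N := distribution N f) c pM trM) => u.
have := mvnormal_mgf (mvnormal_affine 0 C) u.
by rewrite dot0r add0r.
Qed.

Section Tilt.
Variables (tau : 'cV[R]_p) (C : 'M[R]_p).

(** The limit of the likelihood ratios. *)
Definition likelihood_weight (z : 'cV[R]_(p + p)) : R :=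
  expR (dot tau (dsubmx z) - 2^-1 * dot tau (G *m tau)).

Lemma measurable_likelihood_weight : measurable_fun setT likelihood_weight.
Proof.
apply: measurableT_comp => //; apply: measurable_funB => //.
by apply: measurable_dot; apply: measurable_dsubmx; exact: measurable_id.
Qed.

Lemma likelihood_weight_integrable : N.-integrable setT (EFin \o likelihood_weight).
Proof.
apply/integrableP; split; first by apply/measurable_EFinP; exact: measurable_likelihood_weight.
have E z : `|(EFin \o likelihood_weight) z|%E =
    (expR (- (2^-1 * dot tau (G *m tau)) + (dot 0 (usubmx z) + dot tau (dsubmx z))))%:E.
  by rewrite /= ger0_norm ?expR_ge0// dot0l add0r addrC.
by under eq_integral do rewrite E; rewrite mvnormal_block_mgf ltry.
Qed.

Definition tilted : {finite_measure set 'cV[R]_(p + p) -> \bar R} :=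
  density (fun z => expR_ge0 _) likelihood_weight_integrable.

Local Notation K := (regression_mx S C).

Definition limit_test (z : 'cV[R]_(p + p)) : 'cV[R]_p :=
  C *m O *m tau + C *m usubmx z.

(** The score given the value y of the test statistic: its shift under the
local alternatives, the regression on y, and the residual of an
independent copy of the score. *)
Definition limit_score (y : 'cV[R]_p) (z : 'cV[R]_(p + p)) : 'cV[R]_p :=
  (O *m tau + K *m (y - C *m O *m tau)) + (1%:M - K *m C) *m usubmx z.

Definition limit_joint (w : 'cV[R]_(p + p) * 'cV[R]_(p + p)) : 'cV[R]_(p + p) :=
  col_mx (limit_score (limit_test w.1) w.2) (limit_test w.1).

Definition score_test (z : 'cV[R]_(p + p)) : 'cV[R]_(p + p) :=
  col_mx (usubmx z) (C *m usubmx z).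

Lemma measurable_limit_test : measurable_fun setT limit_test.
Proof. exact: measurable_affine_usubmx. Qed.

Lemma measurable_limit_score :
  measurable_fun setT (fun x : 'cV[R]_p * 'cV[R]_(p + p) => limit_score x.1 x.2).
Proof.
apply: measurable_addmx; last first.
  by apply: measurable_mulmxl; apply: measurable_usubmx; exact: measurable_snd.
apply: measurable_addmx; first exact: measurable_cst.
by apply: measurable_mulmxl; apply: measurable_subcst; exact: measurable_fst.
Qed.

Lemma measurable_limit_joint : measurable_fun setT limit_joint.
Proof.
have mt : measurable_fun setT (fun w : 'cV[R]_(p + p) * 'cV[R]_(p + p) => limit_test w.1).
  by apply: (measurableT_comp measurable_limit_test); exact: measurable_fst.
apply: measurable_col_mx => //.
apply: (measurableT_comp measurable_limit_score (g := fun w => (limit_test w.1, w.2))).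
by apply: measurable_fun_pair => //; exact: measurable_snd.
Qed.

Lemma measurable_score_test : measurable_fun setT score_test.
Proof.
have mu := measurable_usubmx (@measurable_id _ 'cV[R]_(p + p) setT).
by apply: measurable_col_mx => //; exact: measurable_mulmxl.
Qed.

Lemma mgf_score_test u : mgf (image_measure tilted measurable_score_test) u =
  (expR (dot (usubmx u + C^T *m dsubmx u) (O *m tau) +
    dot (usubmx u + C^T *m dsubmx u) (S *m (usubmx u + C^T *m dsubmx u)) / 2))%:E.
Proof.
rewrite /mgf (ge0_integral_image _ _ (measurable_expR_dot u) (expR_dot_ge0 u)).
rewrite ge0_integral_density; first last.
- by move=> z; exact: expR_dot_ge0.
- apply/measurable_EFinP; apply: measurableT_comp => //; apply: measurable_dot.
  exact: measurable_score_test.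
set a := usubmx u; set b := dsubmx u.
have E z : (((expR (dot u (score_test z)))%:E * (likelihood_weight z)%:E)%E =
    (expR (- (2^-1 * dot tau (G *m tau)) +
      (dot (a + C^T *m b) (usubmx z) + dot tau (dsubmx z))))%:E).
  rewrite -EFinM -expRD -[u]vsubmxK dot_col_mx col_mxKu col_mxKd -/a -/b.
  by rewrite (dot_mulmx C) dotDl; congr (expR _)%:E; ring.
under eq_integral do rewrite E.
by rewrite mvnormal_block_mgf; congr (expR _)%:E; field.
Qed.

Lemma mgf_limit_joint u : mgf (image_measure (N \x N)%E measurable_limit_joint) u =
  (expR (dot (usubmx u + C^T *m dsubmx u) (O *m tau) +
    dot (usubmx u + C^T *m dsubmx u) (S *m (usubmx u + C^T *m dsubmx u)) / 2))%:E.
Proof.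
rewrite /mgf (ge0_integral_image _ _ (measurable_expR_dot u) (expR_dot_ge0 u)).
rewrite fubini_tonelli1; first last.
- by move=> z; exact: expR_dot_ge0.
- apply/measurable_EFinP; apply: measurableT_comp => //; apply: measurable_dot.
  exact: measurable_limit_joint.
rewrite /fubini_F /=.
set a := usubmx u; set b := dsubmx u; set H := 1%:M - K *m C.
have E y z : dot u (limit_joint (y, z)) =
    (dot (a + C^T *m b) (O *m tau) + dot (K^T *m a + b) (C *m usubmx y)) +
    dot (H^T *m a) (usubmx z).
  rewrite -[u]vsubmxK dot_col_mx col_mxKu col_mxKd -/a -/b /limit_score /limit_test /=.
  rewrite -/H [_ + _ - _]addrAC subrr add0r !dotDr !dotDl -(dot_mulmx C) -(dot_mulmx K).
  by rewrite (dot_mulmx H) -(mulmxA C O); ring.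
under eq_integral => y _.
  under eq_integral do rewrite E.
  rewrite mvnormal_block_mgf1 [X in expR X]addrAC (dot_mulmx C).
  over.
rewrite mvnormal_block_mgf1; congr (expR _)%:E.
rewrite -addrA -mulrDl -(regression_quad_form C mvnormal_block_psd a b); congr (_ + _ / 2).
rewrite addrC; congr (_ + _).
  by rewrite -(dot_mulmx C) !mulmxA.
by rewrite -(dot_mulmx H) !mulmxA.
Qed.

(** Both moment generating functions equal
exp(x' O tau + x' S x / 2) with x = a + C^T b, at the point made of a and b.
For the tilted law, tilting by tau' delta adds the covariance x' O tau and the
normalising constant cancels tau' G tau / 2; for the simulated pair this is
[regression_quad_form]. *)
Lemma tilted_score_test A : measurable A ->
  tilted (score_test @^-1` A) = (N \x N)%E (limit_joint @^-1` A).
Proof. exact: eq_measure_mgf mgf_score_test mgf_limit_joint A. Qed.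

End Tilt.
End GaussianBlock.

(** * The conditional law of the limit given the test statistic *)
Section ConditionalNormality.
Context {R : realType}.

Lemma eq_mvnormal k (N N' : {measure set 'cV[R]_k -> \bar R}) m V :
  (forall A, N A = N' A) -> mvnormal N m V -> mvnormal N' m V.
Proof.
move=> e [VT NV]; split=> // u; have [u0 uN] := NV u; split=> // A mA.
by rewrite -e; exact: uN.
Qed.

(** On a product space, a variable computed from f w.1 and from the independent
coordinate w.2 has a regular conditional law given f w.1, obtained by freezing
the first argument. *)
Lemma cond_normal_product d1 d2 (T1 : measurableType d1) (T2 : measurableType d2)
    (N1 : probability T1 R) (N2 : probability T2 R) k l (f : T1 -> 'cV[R]_l)
    (phi : 'cV[R]_l * T2 -> 'cV[R]_k) m V :
  measurable_fun setT f -> forall mphi : measurable_fun setT phi,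
  (forall y, mvnormal (image_kernel N2 mphi y) (m y) (V y)) ->
  cond_normal (N1 \x N2)%E (fun w => phi (f w.1, w.2)) (fun w => f w.1) m V.
Proof.
move=> mf mphi NV; exists (image_kernel N2 mphi); split => // A B mA mB.
have mD : measurable_fun setT (fun w : T1 * T2 => f w.1).
  by apply: (measurableT_comp mf); exact: measurable_fst.
have mDB : measurable ((fun w : T1 * T2 => f w.1) @^-1` B).
  by have := mD measurableT _ mB; rewrite setTI.
rewrite [RHS]integral_mkcond fubini_tonelli1; first last.
- by move=> w; rewrite erestrict_ge0.
- apply/(measurable_restrictT _ mDB); apply: measurable_funTS.
  by apply: (measurableT_comp (measurable_kernel (image_kernel N2 mphi) A mA)).
rewrite /product_measure1; apply: eq_integral => x _; rewrite /fubini_F /=.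
have Bx y : ((x, y) \in (fun w : T1 * T2 => f w.1) @^-1` B) = (f x \in B) by [].
have [fxB|fxB] := boolP (f x \in B).
  under eq_integral => y _ do rewrite patchE Bx fxB.
  rewrite [RHS](@integral_cst _ _ _ N2 setT measurableT (image_kernel N2 mphi (f x) A)).
  rewrite [X in (_ * X)%E](probability_setT N2) mule1 image_measureE.
  congr (N2 _); apply/seteqP; split=> y; rewrite /xsection /= inE; first by case.
  by split=> //; exact: set_mem.
under eq_integral => y _ do rewrite patchE Bx (negbTE fxB).
rewrite integral0 -[RHS](measure0 N2); congr (N2 _).
move: fxB; rewrite notin_setE => nfxB.
by apply/seteqP; split=> y //; rewrite /xsection /= inE => -[_ /nfxB].
Qed.

End ConditionalNormality.

Section PteLimit.
Context {R : realType} {p : nat}.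
Variables (S O G : 'M[R]_p) (N : probability 'cV[R]_(p + p) R).
Hypothesis gN : mvnormal N 0 (block_mx S O O^T G).
Variables (A UB C : 'M[R]_p) (tau : 'cV[R]_p) (c : R).
Local Notation K := (regression_mx S C).

Definition pte_branch (y : 'cV[R]_p) : 'M[R]_p := if c < sqnorm y then A else UB.

Definition limit_pte (x : 'cV[R]_p * 'cV[R]_(p + p)) : 'cV[R]_p :=
  pte_branch x.1 *m limit_score S O tau C x.1 x.2 - tau.

Lemma measurable_pte_branch d (T : measurableType d) (y s : T -> 'cV[R]_p) :
  measurable_fun setT y -> measurable_fun setT s ->
  measurable_fun setT (fun x => pte_branch (y x) *m s x - tau).
Proof.
move=> my ms; apply: measurable_subcst; rewrite /pte_branch.
have -> : (fun x => (if c < sqnorm (y x) then A else UB) *m s x) =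
    (fun x => if c < sqnorm (y x) then A *m s x else UB *m s x).
  by apply/funext => x; case: ifP.
by apply: measurable_fun_ifT; [apply: measurable_fun_ltr => //; exact: measurable_sqnorm|
  exact: measurable_mulmxl|exact: measurable_mulmxl].
Qed.

Lemma measurable_limit_pte : measurable_fun setT limit_pte.
Proof.
apply: measurable_pte_branch; first exact: measurable_fst.
exact: measurable_limit_score.
Qed.

(** For fixed y the branch is fixed, and the variable is an affine function of
the Gaussian residual. *)
Lemma limit_pte_mvnormal y :
  mvnormal (image_kernel N measurable_limit_pte y)
    ((pte_branch y *m O - 1%:M) *m tau + pte_branch y *m K *m (y - C *m O *m tau))
    (pte_branch y *m (S - K *m C *m S) *m (pte_branch y)^T).
Proof.
set E := pte_branch y; have pS := mvnormal_block_psd gN.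
rewrite -(regression_residual C pS).
have -> : E *m ((1%:M - K *m C) *m S *m (1%:M - K *m C)^T) *m E^T =
    (E *m (1%:M - K *m C)) *m S *m (E *m (1%:M - K *m C))^T by rewrite trmx_mul !mulmxA.
set m := _ + _; apply: eq_mvnormal (mvnormal_affine gN m (E *m (1%:M - K *m C))) => B.
have e : (fun z => limit_pte (y, z)) = (fun z => m + E *m (1%:M - K *m C) *m usubmx z).
  apply/funext => z; rewrite /limit_pte /= -/E /limit_score /m.
  move: (regression_mx S C) (1%:M - _) (y - _) => K H x.
  rewrite !mulmxDr mulmxBl mul1mx !mulmxA.
  by rewrite [_ - tau + _]addrAC [RHS]addrAC.
transitivity (N ((fun z => limit_pte (y, z)) @^-1` B)); last by [].
by rewrite e.
Qed.

Lemma cond_normal_pte :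
  cond_normal (N \x N)%E (fun w => limit_pte (limit_test O tau C w.1, w.2))
    (fun w => limit_test O tau C w.1)
    (fun y => (pte_branch y *m O - 1%:M) *m tau + pte_branch y *m K *m (y - C *m O *m tau))
    (fun y => pte_branch y *m (S - K *m C *m S) *m (pte_branch y)^T).
Proof. by apply: cond_normal_product limit_pte_mvnormal; exact: measurable_limit_test. Qed.

Definition pte_of_score_test (x : 'cV[R]_(p + p)) : 'cV[R]_(p + p) :=
  col_mx (pte_branch (dsubmx x) *m usubmx x - tau) (dsubmx x).

Lemma measurable_pte_of_score_test : measurable_fun setT pte_of_score_test.
Proof.
have mi := @measurable_id _ 'cV[R]_(p + p) setT.
apply: measurable_col_mx; last exact: measurable_dsubmx.
by apply: measurable_pte_branch; [exact: measurable_dsubmx|exact: measurable_usubmx].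
Qed.

Lemma stat_pte0 z : stat_pte A UB C tau c z 0 = pte_of_score_test (score_test C z).
Proof.
rewrite /stat_pte /stat_branch /pte_of_score_test /pte_branch col_mxKu col_mxKd.
by rewrite /stat_test /= !addr0; case: ifP.
Qed.

(** The weighted expectation of the limiting statistic is its expectation for
the simulated pair, by equality of the two laws. *)
Lemma Rintegral_tilted (g : 'cV[R]_(p + p) -> R) :
  measurable_fun setT g -> (forall x, 0 <= g x) ->
  \int[N]_z (g (stat_pte A UB C tau c z 0) * expR (log_weight G tau z 0)) =
  \int[(N \x N)%E]_w g (col_mx (limit_pte (limit_test O tau C w.1, w.2))
    (limit_test O tau C w.1)).
Proof.
move=> mg g0; congr (fine _).
have mgp : measurable_fun setT (fun x => (g (pte_of_score_test x))%:E).
  by apply/measurable_EFinP; apply: (measurableT_comp mg); exact: measurable_pte_of_score_test.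
have gp0 x : (0 <= (g (pte_of_score_test x))%:E)%E by rewrite lee_fin.
transitivity (\int[image_measure (tilted gN tau) (measurable_score_test C)]_x
    (g (pte_of_score_test x))%:E)%E.
  rewrite (ge0_integral_image _ (measurable_score_test C) mgp gp0).
  rewrite (ge0_integral_density _ _ _ (fun z => gp0 (score_test C z))); last first.
    by apply: (measurableT_comp mgp); exact: measurable_score_test.
  by apply: eq_integral => z _; rewrite -EFinM stat_pte0 /log_weight /= addr0.
transitivity (\int[image_measure (N \x N)%E (measurable_limit_joint S O tau C)]_x
    (g (pte_of_score_test x))%:E)%E.
  by apply: eq_measure_integral => B mB _; exact: tilted_score_test.
rewrite (ge0_integral_image _ (measurable_limit_joint S O tau C) mgp gp0).
apply: eq_integral => w _.
by rewrite /pte_of_score_test /limit_joint col_mxKu col_mxKd.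
Qed.

End PteLimit.

(** * Asymptotic normality conditional on the test statistic *)
Section LimitVariables.
Context {R : realType} {p : nat}.
Local Notation T := ('cV[R]_(p + p) * 'cV[R]_(p + p))%type.
Variables (S O A UB C : 'M[R]_p) (tau : 'cV[R]_p) (c : R).

Lemma limit_test_mfun : exists f : {mfun T >-> 'cV[R]_p},
  f = (fun w => limit_test O tau C w.1) :> (_ -> _).
Proof.
have mf : measurable_fun setT (fun w : T => limit_test O tau C w.1).
  by apply: (measurableT_comp (measurable_limit_test O tau C)); exact: measurable_fst.
by exists (mfun_Sub (mem_set mf)).
Qed.

Lemma limit_pte_mfun : exists f : {mfun T >-> 'cV[R]_p},
  f = (fun w => limit_pte S O A UB C tau c (limit_test O tau C w.1, w.2)) :> (_ -> _).
Proof.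
have [D DE] := limit_test_mfun.
have mf : measurable_fun setT
    (fun w => limit_pte S O A UB C tau c (limit_test O tau C w.1, w.2)).
  apply: (measurableT_comp (measurable_limit_pte S O A UB C tau c)
    (g := fun w : T => (limit_test O tau C w.1, w.2))).
  apply: measurable_fun_pair; last exact: measurable_snd.
  by have := measurable_funPT D; rewrite DE.
by exists (mfun_Sub (mem_set mf)).
Qed.

End LimitVariables.

Lemma mu_pteE (R : realType) (p r : nat) (alpha : R) (Upsilon : 'M[R]_(p, r))
    (S O A : 'M[R]_p) (B : 'M[R]_(r, p)) (C : 'M[R]_p) (tau : 'cV[R]_p) :
  let E := pte_branch A (Upsilon *m B) (chi2_quantile (p - r) (1 - alpha)) in
  mu_pte alpha Upsilon S O A B C tau =
  (fun y => (E y *m O - 1%:M) *m tau + E y *m regression_mx S C *m (y - C *m O *m tau)).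
Proof.
apply/funext => y; rewrite /mu_pte /lambda /pte_branch ltNge /regression_mx.
case: (_ <= _) => /=; first by rewrite subrr scale0r add0r scale1r !mulmxA.
by rewrite subr0 scale0r addr0 scale1r !mulmxA.
Qed.

Lemma Gamma_pteE (R : realType) (p r : nat) (alpha : R) (Upsilon : 'M[R]_(p, r))
    (S A : 'M[R]_p) (B : 'M[R]_(r, p)) (C : 'M[R]_p) :
  let E := pte_branch A (Upsilon *m B) (chi2_quantile (p - r) (1 - alpha)) in
  Gamma_pte alpha Upsilon S A B C =
  (fun y => E y *m (S - regression_mx S C *m C *m S) *m (E y)^T).
Proof.
apply/funext => y; rewrite /Gamma_pte /lambda /pte_branch ltNge.
case: (_ <= _) => /=; first by rewrite subrr scale0r add0r scale1r trmx_mul !mulmxA.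
by rewrite subr0 scale0r addr0 scale1r.
Qed.

Theorem theorem2 (R : realType) (p r : nat)
    (d : nat -> measure_display) (X : forall n, measurableType (d n))
    (P : forall n, 'cV[R]_p -> probability (X n) R)
    (Theta : set 'cV[R]_p) (Upsilon : 'M[R]_(p, r)) (alpha : R)
    (nu : nat -> 'M[R]_p)
    (Delta : forall n, 'cV[R]_p -> {mfun X n >-> 'cV[R]_p})
    (Gamma : 'cV[R]_p -> 'M[R]_p)
    (thetaU thetaC : forall n, {mfun X n >-> 'cV[R]_p})
    (phi : forall n, X n -> bool)
    (D : forall n, {mfun X n >-> 'cV[R]_p})
    (S : forall n, 'cV[R]_p -> {mfun X n >-> 'cV[R]_p})
    (Sigma Omega A : 'cV[R]_p -> 'M[R]_p) (B : 'cV[R]_p -> 'M[R]_(r, p))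
    (C : 'cV[R]_p -> 'M[R]_p)
    (theta : 'cV[R]_p) (taun : nat -> 'cV[R]_p) (tau : 'cV[R]_p)
    (hr : (r < p)%N) (hUpsilon : \rank Upsilon = r) (hTheta : open Theta)
    (halpha : 0 < alpha < 1)
    (hU : forall n x, Theta (thetaU n x))
    (hC : forall n x, constraint_set Upsilon Theta (thetaC n x))
    (assumptionA : ULAN P Theta nu Delta Gamma)
    (assumptionB : estimators_and_test P Theta Upsilon alpha nu Delta Gamma
       thetaU thetaC phi D S Sigma Omega A B C)
    (htheta : constraint_set Upsilon Theta theta)
    (htaun : taun @ \oo --> tau)
    (hthetan : forall n, Theta (theta + nu n *m taun n)) :
  exists (d' : measure_display) (T : measurableType d') (Q : probability T R)
    (Z Dlim : {mfun T >-> 'cV[R]_p}),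
    weak_cvg (fun n => P n (theta + nu n *m taun n))
      (fun n x => col_mx
        (invmx (nu n) *m
          (pte (phi n) (thetaU n) (thetaC n) x - (theta + nu n *m taun n)))
        (D n x))
      Q (fun w => col_mx (Z w) (Dlim w)) /\
    cond_normal Q Z Dlim
      (mu_pte alpha Upsilon (Sigma theta) (Omega theta) (A theta) (B theta)
        (C theta) tau)
      (Gamma_pte alpha Upsilon (Sigma theta) (A theta) (B theta) (C theta)).
Proof.
have [ttheta Ttheta] := htheta.
set c := chi2_quantile (p - r) (1 - alpha).
set a := A theta; set ub := Upsilon *m B theta; set cm := C theta.
set g := Gamma theta; set o := Omega theta; set s := Sigma theta.
have nuU := ulan_nu_full_rank assumptionA.
have [N [gN YN]] := et_joint assumptionB Ttheta.
pose t n := taun n - tau.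
(* The remainders in the expansions of the estimators and of the statistic. *)
pose R1 n x := invmx (nu n) *m (thetaU n x - theta) - a *m S n theta x.
pose R2 n x := invmx (nu n) *m (thetaC n x - theta) - ub *m S n theta x.
pose R3 n x := D n x - cm *m S n theta x.
pose Y n x := col_mx (S n theta x) (Delta n theta x).
pose rem n x := (t n, R1 n x, R2 n x, R3 n x).
have mS n : measurable_fun setT (S n theta) by exact: measurable_funPT.
have mY n : measurable_fun setT (Y n) by apply: measurable_col_mx; exact: measurable_funPT.
have mR1 n : measurable_fun setT (R1 n).
  apply: measurable_submx; last exact: measurable_mulmxl.
  by apply: measurable_mulmxl; apply: measurable_subcst; exact: measurable_funPT.
have mR2 n : measurable_fun setT (R2 n).
  apply: measurable_submx; last exact: measurable_mulmxl.
  by apply: measurable_mulmxl; apply: measurable_subcst; exact: measurable_funPT.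
have mR3 n : measurable_fun setT (R3 n).
  by apply: measurable_submx; [exact: measurable_funPT|exact: measurable_mulmxl].
(* As tau_n = tau + t n, the rescaled errors are exactly the function
   [stat_pte] of (S, Delta) and the remainders. *)
have statE n x : col_mx (invmx (nu n) *m
      (pte (phi n) (thetaU n) (thetaC n) x - (theta + nu n *m taun n))) (D n x) =
    stat_pte a ub cm tau c (Y n x) (rem n x).
  have tE : stat_test cm (Y n x) (rem n x) = D n x.
    by rewrite /stat_test col_mxKu addrC subrK.
  rewrite /stat_pte tE; congr col_mx.
  rewrite /pte /stat_branch (et_test assumptionB) -/c /= col_mxKu.
  rewrite [tau + _]addrC subrK opprD addrA mulmxBr mulmxA mulVmx// mul1mx; congr (_ - _).
  case: ifP => _ /=.
    by rewrite scale1r scale0r addr0 [RHS]addrC subrK.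
  by rewrite scale1r scale0r add0r [RHS]addrC subrK.
have llr : oP1 (fun n => P n theta) (fun n x =>
    (log_likelihood_ratio (P n (theta + nu n *m taun n)%R) (P n theta) x -
      (log_weight g tau (Y n x) (rem n x))%:E)%E).
  have btaun : bounded_fun taun by exact: cvg_seq_bounded (cvgP _ htaun).
  have b0 : bounded_fun (fun n => invmx (nu n) *m (theta - theta)).
    by exists 0; split=> // M M0 n _ /=; rewrite subrr mulmx0 normr0 ltW.
  have lwE n x : log_weight g tau (Y n x) (rem n x) =
      ((taun n)^T *m Delta n theta x) 0 0 - 2^-1 * ((taun n)^T *m g *m taun n) 0 0.
    by rewrite /log_weight /= [tau + _]addrC subrK col_mxKd -mulmxA.
  move=> e e0; under eq_fun do under eq_set do rewrite lwE.
  exact: (ulan_expansion assumptionA (thetan := cst theta) Ttheta (fun=> Ttheta) b0 btaun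
    hthetan e0).
have trC : \tr (cm^T *m cm *m s) != 0.
  by rewrite (et_trace assumptionB)// pnatr_eq0 subn_eq0 -ltnNge.
have t0 : t n @[n --> \oo] --> (0 : 'cV[R]_p).
  by rewrite -(subrr tau); apply: cvgB => //; exact: cvg_cst.
have iw : N.-integrable setT (EFin \o (fun z => expR (log_weight g tau z 0))).
  have := likelihood_weight_integrable gN tau; congr (_.-integrable _ _).
  by apply/funext => z; rewrite /log_weight /= addr0.
have [Z ZE] := limit_pte_mfun s o a ub cm tau c.
have [Dlim DE] := limit_test_mfun o cm tau.
exists _, ('cV[R]_(p + p) * 'cV[R]_(p + p))%type, (N \x N)%E, Z, Dlim; split.
  suff lim : weak_cvg (fun n => P n (theta + nu n *m taun n))
      (fun n x => stat_pte a ub cm tau c (Y n x) (rem n x)) (N \x N)%E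
      (fun w => col_mx (Z w) (Dlim w)).
    by move=> h ch bh; under eq_fun do under eq_integral do rewrite statE; exact: lim.
  have mZD : measurable_fun setT (fun w => col_mx (Z w) (Dlim w)).
    by apply: measurable_col_mx; exact: measurable_funPT.
  rewrite ZE DE in mZD *; apply: weak_cvg_liminf => [n||h K ch hK e e0].
  - by apply: measurable_stat_pte => //; exact: measurable_cst.
  - exact: mZD.
  have mh := continuous_measurable_mx ch.
  have := lecam_pte a ub mY mR1 mR2 mR3 YN t0 (et_unconstrained assumptionB Ttheta)
    (et_constrained assumptionB htheta) (et_statistic assumptionB htheta) llr
    (mvnormal_sphere0 gN c trC) iw ch hK e0.
  rewrite (Rintegral_tilted gN)// => x.
  by have /andP[] := hK x.
rewrite ZE DE mu_pteE Gamma_pteE.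
exact: (cond_normal_pte gN a ub cm tau c).
Qed.
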